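(* Let $\rho$ be such that $\omega(1,\rho,1)=1+2\rho$. Suppose $\mathrm{M}^\star(n,n^\rho,n\mid n^{1-\rho})$ requires $n^{2+\rho-o(1)}$ time. Then Min Witness Equality on $n\times n$ matrices requires $n^{2+\rho-o(1)}$ time.
   Context: $\omega(a,b,c)$ is the smallest real $r$ such that an $n^a\times n^b$ by $n^b\times n^c$ integer matrix product can be computed in $O(n^{r+\epsilon})$ time for all $\epsilon>0$. $\mathrm{M}^\star(n_1,n_2,n_3\mid M)$: compute the Min-Plus product $C[i,j]=\min_k(A[i,k]+B[k,j])$ of an $n_1\times n_2$ and an $n_2\times n_3$ matrix with integer entries in $\{0,\dots,M\}$. Min Witness Equality: given $n\times n$ integer matrices $A,B$, compute for every pair $(i,j)$ the value $\min\{k\in[n]: A[i,k]=B[k,j]\}$. *)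

(* Defs.v *)
From Stdlib Require Import Reals ZArith List.
Import ListNotations.

(** * Word RAM *)

Inductive binop : Set :=
  | Add | Sub | Mul | Div | Mod | And | Or | Xor | Shl | Shr.

Definition eval_binop (o : binop) : Z -> Z -> Z :=
  match o with
  | Add => Z.add | Sub => Z.sub | Mul => Z.mul
  | Div => Z.div | Mod => Z.modulo
  | And => Z.land | Or => Z.lor | Xor => Z.lxor
  | Shl => Z.shiftl | Shr => Z.shiftr
  end.

(** Registers are named by [nat]; a program, being a finite list, mentions only
    finitely many of them.  [Read d a] is [d := mem[a]], [Write a s] is
    [mem[a] := s], where the address is the content of register [a]. *)
Inductive instr : Set :=
  | Const (d : nat) (v : Z)
  | Move (d s : nat)
  | Op (o : binop) (d a b : nat)
  | Read (d a : nat)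
  | Write (a s : nat)
  | Jump (l : nat)
  | JumpEq (a b l : nat)
  | JumpLt (a b l : nat)
  | Halt.

Definition program := list instr.

Record state := State { pc : nat; regs : nat -> Z; mem : Z -> Z }.

Definition upd_reg (f : nat -> Z) (r : nat) (v : Z) : nat -> Z :=
  fun r' => if Nat.eqb r' r then v else f r'.

Definition upd_mem (f : Z -> Z) (a v : Z) : Z -> Z :=
  fun a' => if Z.eqb a' a then v else f a'.

Definition halted (p : program) (s : state) : Prop :=
  nth_error p (pc s) = None \/ nth_error p (pc s) = Some Halt.

(** A halted state is a fixed point of [step]. *)
Definition step (p : program) (s : state) : state :=
  let R := regs s in
  match nth_error p (pc s) with
  | None | Some Halt => s
  | Some (Const d v) => State (S (pc s)) (upd_reg R d v) (mem s)
  | Some (Move d r) => State (S (pc s)) (upd_reg R d (R r)) (mem s)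
  | Some (Op o d a b) =>
      State (S (pc s)) (upd_reg R d (eval_binop o (R a) (R b))) (mem s)
  | Some (Read d a) => State (S (pc s)) (upd_reg R d (mem s (R a))) (mem s)
  | Some (Write a r) => State (S (pc s)) R (upd_mem (mem s) (R a) (R r))
  | Some (Jump l) => State l R (mem s)
  | Some (JumpEq a b l) =>
      State (if Z.eqb (R a) (R b) then l else S (pc s)) R (mem s)
  | Some (JumpLt a b l) =>
      State (if Z.ltb (R a) (R b) then l else S (pc s)) R (mem s)
  end.

Definition run (p : program) (t : nat) (s : state) : state :=
  Nat.iter t (step p) s.

(** The input occupies memory cells 0, 1, 2, ...; everything else is 0. *)
Definition init (x : list Z) : state :=
  State 0 (fun _ => 0%Z)
    (fun a => if Z.ltb a 0 then 0%Z else nth (Z.to_nat a) x 0%Z).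

(** Every register and every memory cell holds a signed integer of absolute
    value less than [2 ^ w]. *)
Definition fits (w : nat) (s : state) : Prop :=
  (forall r, Z.abs (regs s r) < 2 ^ Z.of_nat w)%Z /\
  (forall a, Z.abs (mem s a) < 2 ^ Z.of_nat w)%Z.

(** * Problems and running time *)

(** Instances are graded by the parameter [n] in which running times are
    measured.  [answer n x out] says that [out 0, out 1, ...] (the memory cells
    at halting time) is a correct output for the instance [x]. *)
Record problem := Problem {
  instance : nat -> Type;
  encode : forall n, instance n -> list Z;
  answer : forall n, instance n -> (nat -> Z) -> Prop }.

(** Words have O(log n) bits: the algorithm chooses the constant [c], and a run
    counts only if no word ever overflows. *)
Definition word_size (c n : nat) : nat := c * S (Nat.log2 n).

Definition solvable_in_O_pow (P : problem) (alpha : R) : Prop :=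
  exists (p : program) (c : nat) (K : R),
    forall n, (1 <= n)%nat -> forall x : instance P n,
      let s0 := init (encode P n x) in
      (forall t, fits (word_size c n) (run p t s0)) /\
      exists t : nat,
        (INR t <= K * Rpower (INR n) alpha)%R /\
        halted p (run p t s0) /\
        answer P n x (fun i => mem (run p t s0) (Z.of_nat i)).

(** "[P] requires n^(alpha - o(1)) time". *)
Definition requires_time (P : problem) (alpha : R) : Prop :=
  forall eps : R, (0 < eps)%R -> ~ solvable_in_O_pow P (alpha - eps).

(** * Matrices *)

(** An [m] by [n] integer matrix is a function whose values at [(i, j)] with
    [i < m], [j < n] matter; it is stored in row-major order. *)
Definition matrix := nat -> nat -> Z.

Definition row_major (m n : nat) (A : matrix) : list Z :=
  flat_map (fun i => map (A i) (seq 0 n)) (seq 0 m).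

Definition matrix_of_cells (n : nat) (out : nat -> Z) : matrix :=
  fun i j => out (i * n + j)%nat.

Definition entries_in (lo hi : Z) (m n : nat) (A : matrix) : Prop :=
  forall i j, (i < m)%nat -> (j < n)%nat -> (lo <= A i j <= hi)%Z.

(** A pair of matrices of sizes [n1] by [n2] and [n2] by [n3]. *)
Record matrix_pair (lo hi : Z) (n1 n2 n3 : nat) := MatrixPair {
  matA : matrix;
  matB : matrix;
  matA_in : entries_in lo hi n1 n2 matA;
  matB_in : entries_in lo hi n2 n3 matB }.

Arguments matA {lo hi n1 n2 n3} _.
Arguments matB {lo hi n1 n2 n3} _.

Definition encode_pair {lo hi : Z} {n1 n2 n3 : nat}
    (x : matrix_pair lo hi n1 n2 n3) : list Z :=
  row_major n1 n2 (matA x) ++ row_major n2 n3 (matB x).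

Definition nceil (x : R) : nat := Z.to_nat (- Int_part (- x)).
Definition nfloor (x : R) : nat := Z.to_nat (Int_part x).

(** n^a as a matrix dimension. *)
Definition npow (n : nat) (a : R) : nat := nceil (Rpower (INR n) a).

(** * Integer matrix multiplication and omega *)

Definition poly_bound (kappa n : nat) : Z := (Z.of_nat n ^ Z.of_nat kappa)%Z.

Definition is_product (n1 n2 n3 : nat) (A B C : matrix) : Prop :=
  forall i j, (i < n1)%nat -> (j < n3)%nat ->
    C i j = fold_right Z.add 0%Z (map (fun k => A i k * B k j)%Z (seq 0 n2)).

(** Multiply n^a by n^b and n^b by n^c integer matrices with entries in
    [{-n^kappa, ..., n^kappa}]. *)
Definition MatrixMult (a b c : R) (kappa : nat) : problem := {|
  instance n := matrix_pair (- poly_bound kappa n) (poly_bound kappa n)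
                  (npow n a) (npow n b) (npow n c);
  encode n x := map Z.of_nat [npow n a; npow n b; npow n c] ++ encode_pair x;
  answer n x out := is_product (npow n a) (npow n b) (npow n c)
                      (matA x) (matB x) (matrix_of_cells (npow n c) out) |}.

Definition omega_bound (a b c r : R) : Prop :=
  forall eps : R, (0 < eps)%R ->
  forall kappa : nat, solvable_in_O_pow (MatrixMult a b c kappa) (r + eps).

(** [is_omega a b c r]: omega(a,b,c) = r. *)
Definition is_omega (a b c r : R) : Prop :=
  omega_bound a b c r /\ forall r', omega_bound a b c r' -> (r <= r')%R.

(** * Min-Plus product *)

Definition is_min_plus (n1 n2 n3 : nat) (A B C : matrix) : Prop :=
  forall i j, (i < n1)%nat -> (j < n3)%nat ->
    (exists k, (k < n2)%nat /\ C i j = (A i k + B k j)%Z) /\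
    (forall k, (k < n2)%nat -> (C i j <= A i k + B k j)%Z).

(** M*(n1, n2, n3 | M), the dimensions and the bound being functions of n. *)
Definition MStar (n1 n2 n3 M : nat -> nat) : problem := {|
  instance n := matrix_pair 0 (Z.of_nat (M n)) (n1 n) (n2 n) (n3 n);
  encode n x := map Z.of_nat [n1 n; n2 n; n3 n; M n] ++ encode_pair x;
  answer n x out := is_min_plus (n1 n) (n2 n) (n3 n)
                      (matA x) (matB x) (matrix_of_cells (n3 n) out) |}.

(** * Min Witness Equality *)

(** Indices are numbered from 0 in [matrix] but from 1 in [[n] = {1, ..., n}],
    hence the successor; 0 encodes the minimum of the empty set. *)
Definition is_min_witness (n : nat) (A B C : matrix) : Prop :=
  forall i j, (i < n)%nat -> (j < n)%nat ->
    (exists k, (k < n)%nat /\ A i k = B k j /\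
       (forall k', (k' < n)%nat -> A i k' = B k' j -> (k <= k')%nat) /\
       C i j = Z.of_nat (S k)) \/
    ((forall k, (k < n)%nat -> A i k <> B k j) /\ C i j = 0%Z).

(** Entries are in [{-n^kappa, ..., n^kappa}]. *)
Definition MinWitnessEq (kappa : nat) : problem := {|
  instance n := matrix_pair (- poly_bound kappa n) (poly_bound kappa n) n n n;
  encode n x := Z.of_nat n :: encode_pair x;
  answer n x out := is_min_witness n
                      (matA x) (matB x) (matrix_of_cells n out) |}.

(* Main.v *)
From Stdlib Require Import Reals ZArith List FinFun Lia Lra.
Require Import Defs.
Import ListNotations.

(** For [0 < rho <= 1], put [n2 = n^rho], [M = n^(1-rho)] and [N = (2M+1) n2], so that
    [n <= N <= 6n].  Index the inner dimension by pairs [(v, k)] with [0 <= v <= 2M]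
    and [k < n2], in lexicographic order, and let [A' i (v, k) = v - A i k],
    [B' (v, k) j = B k j].  An equality witness is a pair with [A i k + B k j = v], so
    the [v] of the least witness is the Min-Plus entry.  A RAM program writes
    [A'] and [B'], runs the given Min Witness Equality program and extracts [v],
    all with [O(n^2)] overhead, which is absorbed since [rho > 0].

    The other values of [rho] are degenerate.  If [rho <= 0], then writing the output
    already takes time [n^2].  If [rho > 1], then [M = 0] for [n >= 2], the
    Min-Plus product is zero and is written in time [O(n^2)], against the hypothesis. *)

Open Scope Z_scope.

(** * Reasoning about word RAM programs *)

(** The factor [2M+1] counts the possible sums, which lie in [0..2M]. The bound [n <= N] leaves room
    for the [n] outer rows and columns inside a square instance of size [N]; the bound [N <= 6n]
    makes passing from [N] to [n] cost only constant factors. The formal difficulty is the black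
    box. The given program is arbitrary, and its behavior is known only from an initial state: its
    input in cells 0, 1, 2, ..., all other cells and all registers 0. The surrounding code must
    therefore erase its own traces before handing over. Memory cannot keep anything safe during the
    call, since the program may write anywhere; but registers have fixed names, so renaming protects
    the sizes needed afterwards. Overflow must moreover be excluded at every moment of the combined
    run, so each execution statement carries a word bound along with its time. *)

Definition code_at (P : program) (b : nat) (f : list instr) : Prop :=
  forall k i, nth_error f k = Some i -> nth_error P (b + k)%nat = Some i.

(** The bound is imposed at all intermediate times, because a run counts only if no word overflows
    along the way. *)
Definition reaches (P : program) (w t : nat) (s s' : state) : Prop :=
  run P t s = s' /\ forall u, (u <= t)%nat -> fits w (run P u s).

Lemma run_add P t1 t2 s : run P (t1 + t2) s = run P t2 (run P t1 s).
Proof. unfold run. rewrite Nat.add_comm. apply Nat.iter_add. Qed.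

Lemma run_halted P t s : halted P s -> run P t s = s.
Proof.
  intros H. induction t as [|t IH]; [reflexivity|].
  change (step P (run P t s) = s). rewrite IH. unfold step.
  destruct H as [H|H]; rewrite H; reflexivity.
Qed.

Lemma reaches_refl P w s : fits w s -> reaches P w 0 s s.
Proof.
  intros H. split; [reflexivity|]. intros u Hu.
  replace u with 0%nat by lia. exact H.
Qed.

Lemma reaches_step P w s : fits w s -> fits w (step P s) -> reaches P w 1 s (step P s).
Proof.
  intros H H'. split; [reflexivity|]. intros u Hu.
  destruct u as [|[|u]]; [exact H | exact H' | lia].
Qed.

Lemma reaches_trans P w t1 t2 s1 s2 s3 :
  reaches P w t1 s1 s2 -> reaches P w t2 s2 s3 -> reaches P w (t1 + t2) s1 s3.
Proof.
  intros [E1 F1] [E2 F2]. split.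
  - rewrite run_add, E1. exact E2.
  - intros u Hu. destruct (Nat.le_gt_cases u t1) as [Hle|Hgt]; [auto|].
    replace u with (t1 + (u - t1))%nat by lia. rewrite run_add, E1. apply F2. lia.
Qed.

Lemma reaches_fits_end P w t s s' : reaches P w t s s' -> fits w s'.
Proof. intros [<- F]. apply F. lia. Qed.

Lemma reaches_halted_fits P w t s s' :
  reaches P w t s s' -> halted P s' -> forall u, fits w (run P u s).
Proof.
  intros [E F] H u. destruct (Nat.le_gt_cases u t) as [Hle|Hgt]; [auto|].
  replace u with (t + (u - t))%nat by lia.
  rewrite run_add, E, run_halted by exact H. rewrite <- E. apply F. lia.
Qed.

Lemma code_at_app P b f g :
  code_at P b (f ++ g) <-> code_at P b f /\ code_at P (b + length f) g.
Proof.
  unfold code_at. split.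
  - intros H. split; intros k i Hk.
    + apply H. rewrite nth_error_app1; [exact Hk|]. apply nth_error_Some. congruence.
    + rewrite <- Nat.add_assoc. apply H.
      rewrite nth_error_app2 by lia. rewrite <- Hk. f_equal. lia.
  - intros [H1 H2] k i Hk. destruct (Nat.lt_ge_cases k (length f)) as [Hl|Hl].
    + rewrite nth_error_app1 in Hk by exact Hl. auto.
    + rewrite nth_error_app2 in Hk by exact Hl. apply H2 in Hk.
      rewrite <- Hk. f_equal. lia.
Qed.

Lemma code_at_cons P b i f : code_at P b (i :: f) ->
  nth_error P b = Some i /\ code_at P (S b) f.
Proof.
  intros H. split.
  - rewrite <- (Nat.add_0_r b). apply H. reflexivity.
  - intros k j Hk. rewrite Nat.add_succ_comm. apply H. exact Hk.
Qed.

Lemma code_at_0 P : code_at P 0 P.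
Proof. intros k i H. exact H. Qed.

Lemma fits_upd_reg w b b' R m d v : fits w (State b R m) ->
  Z.abs v < 2 ^ Z.of_nat w -> fits w (State b' (upd_reg R d v) m).
Proof.
  intros [HR Hm] Hv. split; [|exact Hm]. intros r. cbn. unfold upd_reg.
  destruct (Nat.eqb r d); [exact Hv | apply HR].
Qed.

Lemma fits_upd_mem w b b' R m a r : fits w (State b R m) ->
  fits w (State b' R (upd_mem m a (R r))).
Proof.
  intros [HR Hm]. split; [exact HR|]. intros c. cbn. unfold upd_mem.
  destruct (Z.eqb c a); [apply HR | apply Hm].
Qed.

(** No word may reach absolute value [W]; jumps get the precondition [False]. *)
Fixpoint wp (W : Z) (l : list instr) (Q : (nat -> Z) -> (Z -> Z) -> Prop)
    (R : nat -> Z) (m : Z -> Z) : Prop :=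
  match l with
  | [] => Q R m
  | Const d v :: l' => Z.abs v < W /\ wp W l' Q (upd_reg R d v) m
  | Op o d a b :: l' =>
      forall v, v = eval_binop o (R a) (R b) ->
      Z.abs v < W /\ wp W l' Q (upd_reg R d v) m
  | Read d a :: l' => forall v, v = m (R a) -> wp W l' Q (upd_reg R d v) m
  | Write a r :: l' => wp W l' Q R (upd_mem m (R a) (R r))
  | _ => False
  end.

(** [Read] and [Write] copy a word that already fits, so [wp] owes a size bound only where a new
    value arises, at [Const] and [Op]. *)
Lemma wp_reaches P w l Q : forall b R m,
  code_at P b l -> fits w (State b R m) -> wp (2 ^ Z.of_nat w) l Q R m ->
  exists R' m',
    reaches P w (length l) (State b R m) (State (b + length l) R' m') /\ Q R' m'.
Proof.
  induction l as [|i l IH]; intros b R m Hc Hf Hwp.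
  - exists R, m. rewrite Nat.add_0_r. split; [apply reaches_refl; exact Hf | exact Hwp].
  - apply code_at_cons in Hc. destruct Hc as [Hi Hc].
    assert (Hstep : exists R1 m1, step P (State b R m) = State (S b) R1 m1 /\
              fits w (State (S b) R1 m1) /\ wp (2 ^ Z.of_nat w) l Q R1 m1).
    { unfold step; cbn [pc regs mem]; rewrite Hi.
      destruct i; cbn [wp] in Hwp; try contradiction.
      - destruct Hwp as [Hv Hwp]. do 2 eexists. split; [reflexivity|].
        split; [eapply fits_upd_reg; eassumption | exact Hwp].
      - destruct (Hwp _ eq_refl) as [Hv Hwp']. do 2 eexists. split; [reflexivity|].
        split; [eapply fits_upd_reg; eassumption | exact Hwp'].
      - do 2 eexists. split; [reflexivity|].
        split; [eapply fits_upd_reg; [eassumption | apply Hf] | apply Hwp; reflexivity].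
      - do 2 eexists. split; [reflexivity|].
        split; [eapply fits_upd_mem; eassumption | exact Hwp]. }
    destruct Hstep as (R1 & m1 & Hs & Hf1 & Hwp1).
    destruct (IH _ _ _ Hc Hf1 Hwp1) as (R' & m' & Hr & HQ).
    exists R', m'. split; [|exact HQ].
    cbn [length]. rewrite <- Nat.add_succ_comm.
    apply (reaches_trans P w 1 (length l) _ (State (S b) R1 m1)); [|exact Hr].
    rewrite <- Hs. apply reaches_step; [exact Hf|]. rewrite Hs. exact Hf1.
Qed.

(** The body is executed at least once; [b] is the absolute address of the loop. *)
Definition loop (b : nat) (body : list instr) (cnt lim one : nat) : list instr :=
  (body ++ [Op Add cnt cnt one]) ++ [JumpLt cnt lim b].

Lemma loop_length b body cnt lim one :
  length (loop b body cnt lim one) = (length body + 2)%nat.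
Proof. unfold loop. rewrite !length_app. cbn. lia. Qed.

(** [Inv k] describes the state on entry to round [k]; the induction is on the number [c - k] of
    rounds left. The [+ 2] per round is the increment and the test. *)
Lemma loop_reaches P w b body cnt lim one (Inv : Z -> (nat -> Z) -> (Z -> Z) -> Prop) c :
  code_at P b (loop b body cnt lim one) ->
  (forall k R m, 0 <= k < c -> Inv k R m ->
     wp (2 ^ Z.of_nat w) (body ++ [Op Add cnt cnt one])
       (fun R' m' => R' cnt = k + 1 /\ R' lim = c /\ Inv (k + 1) R' m') R m) ->
  0 < c ->
  forall R m, fits w (State b R m) -> Inv 0 R m ->
  exists t R' m', Z.of_nat t <= c * (Z.of_nat (length body) + 2) /\
    reaches P w t (State b R m) (State (b + (length body + 2)) R' m') /\ Inv c R' m'.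
Proof.
  intros Hc Hbody Hpos.
  assert (H : forall d : nat, forall k R m, 0 <= k < c -> c - k = Z.of_nat d ->
            fits w (State b R m) -> Inv k R m ->
            exists t R' m', Z.of_nat t <= (c - k) * (Z.of_nat (length body) + 2) /\
              reaches P w t (State b R m) (State (b + (length body + 2)) R' m') /\
              Inv c R' m').
  { unfold loop in Hc. apply code_at_app in Hc. destruct Hc as [Hc Hj].
    apply code_at_cons in Hj. destruct Hj as [Hj _].
    rewrite length_app in Hj. cbn [length] in Hj.
    induction d as [|d IH]; intros k R m Hk Hd Hf HI; [lia|].
    destruct (wp_reaches P w _ _ b R m Hc Hf (Hbody k R m Hk HI))
      as (R1 & m1 & Hr & Hcnt & Hlim & HI1).
    rewrite length_app in Hr. cbn [length] in Hr.
    pose proof (reaches_fits_end _ _ _ _ _ Hr) as Hf1.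
    assert (Hs : step P (State (b + (length body + 1)) R1 m1) =
                 State (if k + 1 <? c then b else (b + (length body + 2))%nat) R1 m1).
    { unfold step. cbn [pc regs mem]. rewrite Hj, Hcnt, Hlim.
      f_equal. destruct (k + 1 <? c); lia. }
    assert (Hr1 : reaches P w (length body + 2) (State b R m)
              (State (if k + 1 <? c then b else (b + (length body + 2))%nat) R1 m1)).
    { replace (length body + 2)%nat with (length body + 1 + 1)%nat at 1 by lia.
      eapply reaches_trans; [exact Hr|]. rewrite <- Hs.
      apply reaches_step; [exact Hf1|]. rewrite Hs. exact Hf1. }
    destruct (Z.ltb_spec (k + 1) c) as [Hlt|Hge].
    - destruct (IH (k + 1) R1 m1) as (t & R' & m' & Ht & Hr2 & HIc);
        [lia | lia | exact Hf1 | exact HI1 |].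
      exists (length body + 2 + t)%nat, R', m'. split; [nia|].
      split; [eapply reaches_trans; eassumption | exact HIc].
    - exists (length body + 2)%nat, R1, m1. split; [nia|]. split; [exact Hr1|].
      replace c with (k + 1) by lia. exact HI1. }
  intros R m Hf HI.
  destruct (H (Z.to_nat c) 0 R m) as (t & R' & m' & Ht & Hr); try assumption; try lia.
  exists t, R', m'. rewrite Z.sub_0_r in Ht. auto.
Qed.

(** * Running a program inside another one *)

(** Every way of halting must lead to the one address [off + len]: [Halt] becomes a jump there, and
    a target past the end of the code, where the original would halt, is cut down to it. *)
Definition relocate_instr (off len : nat) (i : instr) : instr :=
  let r x := (16 + x)%nat in
  let l x := (off + Nat.min x len)%nat in
  match i with
  | Const d v => Const (r d) v
  | Move d s => Move (r d) (r s)
  | Op o d a b => Op o (r d) (r a) (r b)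
  | Read d a => Read (r d) (r a)
  | Write a s => Write (r a) (r s)
  | Jump x => Jump (l x)
  | JumpEq a b x => JumpEq (r a) (r b) (l x)
  | JumpLt a b x => JumpLt (r a) (r b) (l x)
  | Halt => Jump (off + len)
  end.

(** Registers 0, ..., 15 are left to the surrounding program. *)
Definition relocate (off : nat) (p : program) : program :=
  map (relocate_instr off (length p)) p.

(** The [Nat.min] identifies all halting positions past the end of [p] with the exit address. [G]
    records the registers of the surrounding program, frozen during the call. *)
Definition simulates (off : nat) (p : program) (G : nat -> Z) (s s' : state) : Prop :=
  pc s' = (off + Nat.min (pc s) (length p))%nat /\
  (forall r, regs s' (16 + r)%nat = regs s r) /\
  (forall a, mem s' a = mem s a) /\
  (forall r, (r < 16)%nat -> regs s' r = G r).

Lemma simulates_fits w off p G s s' : simulates off p G s s' ->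
  (forall r, (r < 16)%nat -> Z.abs (G r) < 2 ^ Z.of_nat w) -> fits w s -> fits w s'.
Proof.
  intros (_ & Hr & Hm & HG) Hb [Fr Fm]. split.
  - intros r. destruct (Nat.lt_ge_cases r 16) as [H|H].
    + rewrite HG by exact H. auto.
    + replace r with (16 + (r - 16))%nat by lia. rewrite Hr. apply Fr.
  - intros a. rewrite Hm. apply Fm.
Qed.

Lemma upd_reg_shift R R' d v : (forall r, R' (16 + r)%nat = R r) ->
  forall r, upd_reg R' (16 + d) v (16 + r)%nat = upd_reg R d v r.
Proof. intros H r. unfold upd_reg. cbn. destruct (Nat.eqb r d); [reflexivity | apply H]. Qed.

Lemma upd_reg_low R d v r : (r < 16)%nat -> upd_reg R (16 + d) v r = R r.
Proof. intros H. unfold upd_reg. destruct (Nat.eqb_spec r (16 + d)); [lia | reflexivity]. Qed.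

Lemma simulates_step P off p G s s' : code_at P off (relocate off p) ->
  simulates off p G s s' -> ~ halted p s -> simulates off p G (step p s) (step P s').
Proof.
  intros Hc (Hpc & Hr & Hm & HG) Hh.
  destruct (nth_error p (pc s)) as [i|] eqn:Hi; [|exfalso; apply Hh; left; exact Hi].
  assert (Hlt : (pc s < length p)%nat) by (apply nth_error_Some; congruence).
  assert (HP : nth_error P (pc s') = Some (relocate_instr off (length p) i)).
  { rewrite Hpc, Nat.min_l by lia. apply Hc. unfold relocate.
    rewrite nth_error_map, Hi. reflexivity. }
  unfold step. rewrite Hi, HP.
  destruct i; cbn [relocate_instr];
    try (exfalso; apply Hh; right; exact Hi); unfold simulates; cbn [pc regs mem];
    rewrite ?Hr, ?Hm; repeat split; try assumption;
    try (intros; apply upd_reg_shift; assumption);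
    try (intros; rewrite upd_reg_low by assumption; auto; fail);
    try (rewrite Hpc; lia).
  - intros x. unfold upd_mem. destruct (Z.eqb x _); auto.
  - destruct (Z.eqb _ _); [reflexivity | rewrite Hpc; lia].
  - destruct (Z.ltb _ _); [reflexivity | rewrite Hpc; lia].
Qed.

Lemma halted_dec p s : {halted p s} + {~ halted p s}.
Proof.
  unfold halted. destruct (nth_error p (pc s)) as [[]|];
    ((left; auto; fail) || (right; intros [H|H]; discriminate)).
Qed.

(** Induction on [t] over all related pairs of states, stopping as soon as [p] halts. The one step
    beyond [t] is the jump that replaces [Halt]. *)
Lemma relocate_reaches P w off p G : code_at P off (relocate off p) ->
  (forall r, (r < 16)%nat -> Z.abs (G r) < 2 ^ Z.of_nat w) ->
  forall t s s', simulates off p G s s' -> (forall u, fits w (run p u s)) ->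
  halted p (run p t s) ->
  exists u s'', (u <= t + 1)%nat /\ reaches P w u s' s'' /\
    pc s'' = (off + length p)%nat /\
    (forall a, mem s'' a = mem (run p t s) a) /\
    (forall r, (r < 16)%nat -> regs s'' r = G r).
Proof.
  intros Hc Hb.
  induction t as [|t IH]; intros s s' Hs Hf Hh; destruct (halted_dec p s) as [H|H];
    try contradiction;
    pose proof (simulates_fits w _ _ _ _ _ Hs Hb (Hf 0%nat)) as Hf'.
  1, 2: rewrite (run_halted p _ s H);
    destruct Hs as (Hpc & Hr & Hm & HG);
    destruct H as [H|H];
    [ apply nth_error_None in H; exists 0%nat, s';
      split; [lia|]; split; [apply reaches_refl; exact Hf'|]; split; [lia | auto] | ];
    exists 1%nat, (step P s');
    assert (Hlt : (pc s < length p)%nat) by (apply nth_error_Some; congruence);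
    assert (HP : nth_error P (pc s') = Some (Jump (off + length p)))
      by (rewrite Hpc, Nat.min_l by lia; apply Hc; unfold relocate;
          rewrite nth_error_map, H; reflexivity);
    assert (E : step P s' = State (off + length p) (regs s') (mem s'))
      by (unfold step; rewrite HP; reflexivity);
    split; [lia|]; split; [apply reaches_step; [exact Hf' | rewrite E; exact Hf']|];
    rewrite E; cbn; auto.
  pose proof (simulates_step _ _ _ _ _ _ Hc Hs H) as Hs1.
  destruct (IH (step p s) (step P s') Hs1) as (u & s'' & Hu & Hr & Hrest).
  - intros u. specialize (Hf (1 + u)%nat). rewrite run_add in Hf. exact Hf.
  - change (S t) with (1 + t)%nat in Hh. rewrite run_add in Hh. exact Hh.
  - exists (1 + u)%nat, s''. split; [lia|]. split.
    + eapply reaches_trans; [|exact Hr]. apply reaches_step; [exact Hf'|].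
      eapply simulates_fits; [exact Hs1 | exact Hb |]. exact (Hf 1%nat).
    + change (S t) with (1 + t)%nat. rewrite run_add. exact Hrest.
Qed.

(** * Input layout *)

Lemma row_major_length m n A : length (row_major m n A) = (m * n)%nat.
Proof.
  unfold row_major. rewrite (flat_map_constant_length (c := n)), length_seq; [reflexivity|].
  intros i _. rewrite length_map, length_seq. reflexivity.
Qed.

Lemma row_major_succ m n A :
  row_major (S m) n A = row_major m n A ++ map (A m) (seq 0 n).
Proof. unfold row_major. rewrite seq_S, flat_map_app. cbn. rewrite app_nil_r. reflexivity. Qed.

Lemma nth_row_major m n A i j : (i < m)%nat -> (j < n)%nat ->
  nth (i * n + j) (row_major m n A) 0 = A i j.
Proof.
  intros Hi Hj. induction m as [|m IH]; [lia|]. rewrite row_major_succ.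
  destruct (Nat.lt_ge_cases i m) as [H|H].
  - rewrite app_nth1 by (rewrite row_major_length; nia). auto.
  - replace i with m by lia. rewrite app_nth2; rewrite row_major_length; [|lia].
    replace (m * n + j - m * n)%nat with j by lia.
    rewrite (nth_indep _ 0 (A m 0%nat)) by (rewrite length_map, length_seq; lia).
    rewrite map_nth, seq_nth by lia. reflexivity.
Qed.

Lemma Forall_row_major (P : Z -> Prop) m n A :
  (forall i j, (i < m)%nat -> (j < n)%nat -> P (A i j)) -> Forall P (row_major m n A).
Proof.
  intros H. apply Forall_forall. intros x Hx. unfold row_major in Hx.
  apply in_flat_map in Hx. destruct Hx as (i & Hi & Hx).
  apply in_map_iff in Hx. destruct Hx as (j & <- & Hj).
  apply in_seq in Hi, Hj. apply H; lia.
Qed.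

Lemma fits_init w x : Forall (fun v => Z.abs v < 2 ^ Z.of_nat w) x -> fits w (init x).
Proof.
  intros H. assert (Hp : 0 < 2 ^ Z.of_nat w) by (apply Z.pow_pos_nonneg; lia).
  split; cbn; [intros _; exact Hp|]. intros a. destruct (a <? 0); [exact Hp|].
  destruct (Nat.lt_ge_cases (Z.to_nat a) (length x)) as [Hl|Hl].
  - rewrite Forall_forall in H. apply H, nth_In, Hl.
  - rewrite nth_overflow by exact Hl. exact Hp.
Qed.

Lemma mem_init x k : mem (init x) (Z.of_nat k) = nth k x 0.
Proof. cbn. destruct (Z.ltb_spec (Z.of_nat k) 0); [lia|]. rewrite Nat2Z.id. reflexivity. Qed.

(** * The reduction *)

(** Register allocation: 0, 1, 2, 3 hold [n], [n2], [M], [N]; 4 is the loop counter;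
    5 holds [N * N] (later [n * n]); 6, 8, 13 hold the constants 1, 0, -5;
    9 and 10 hold [n * n2] and the input length; the others are scratch. *)
Definition read_sizes : list instr :=
  [ Const 6 1; Const 7 3; Const 8 0; Read 0 8; Read 1 6; Read 2 7;
    Op Add 3 2 2; Op Add 3 3 6; Op Mul 3 3 1;
    Op Mul 9 0 1; Op Add 10 9 9; Op Add 10 10 6; Op Add 10 10 7; Const 4 0 ].

(** The input cell [a] moves to the negative address [-1-a], away from the matrices
    to be written. *)
Definition move_body : list instr :=
  [ Read 11 4; Op Sub 12 8 4; Op Sub 12 12 6; Write 12 11; Write 4 8 ].

(** Matrix entry number [a] of the input starts in cell [4 + a], after the four sizes, and is moved
    to [-1 - (4 + a) = -5 - a]; hence the constant -5. *)
Definition before_fill : list instr := [ Op Mul 5 3 3; Const 4 0; Const 13 (-5) ].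

Definition fill_body : list instr :=
  [ Op Div 11 4 3; Op Mod 12 4 3; Op Div 14 12 1; Op Mod 12 12 1;
    Op Mul 11 11 1; Op Add 11 11 12; Op Sub 11 13 11; Read 11 11; Op Sub 11 14 11;
    Op Add 12 4 6; Write 12 11;
    Op Div 11 4 3; Op Mod 11 11 1; Op Mod 14 4 3; Op Mul 11 11 0;
    Op Add 11 11 14; Op Add 11 11 9; Op Sub 11 13 11; Read 11 11;
    Op Add 12 12 5; Write 12 11 ].

(** The embedded program expects all cells outside its input to be 0. *)
Definition clear_body : list instr := [ Op Sub 12 8 4; Op Sub 12 12 6; Write 12 8 ].

(** The numbers 14, 24 and 48 are the absolute addresses of the loops, that is, the lengths of the
    code before them. The final [Write] puts the size [N] at the head of the new input. *)
Definition prepare : list instr :=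
  read_sizes ++ loop 14 move_body 4 10 6 ++ before_fill ++ loop 24 fill_body 4 5 6 ++
  [Const 4 0] ++ loop 48 clear_body 4 10 6 ++ [Write 8 3].

(** Rows of [left_cell] and columns of [right_cell] beyond [n] read unrelated input
    cells; these still lie in [0, M], and the corresponding outputs are ignored. *)
Definition left_cell (n2 N : Z) (X : Z -> Z) (a : Z) : Z :=
  a mod N / n2 - X (4 + (a / N * n2 + (a mod N) mod n2)).

Definition right_cell (n n2 N : Z) (X : Z -> Z) (a : Z) : Z :=
  X (4 + ((a / N) mod n2 * n + a mod N + n * n2)).

Definition prepared_mem (n n2 N : Z) (X : Z -> Z) (a : Z) : Z :=
  if a <? 0 then 0 else if a =? 0 then N
  else if a <? 1 + N * N then left_cell n2 N X (a - 1)
  else if a <? 1 + N * N + N * N then right_cell n n2 N X (a - 1 - N * N)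
  else 0.

(** The last clause keeps the registers of the embedded program at 0, as its initial state
    demands. *)
Definition sizes_loaded (n n2 N : Z) (R : nat -> Z) : Prop :=
  R 0%nat = n /\ R 1%nat = n2 /\ R 3%nat = N /\ R 6%nat = 1 /\ R 8%nat = 0 /\
  R 9%nat = n * n2 /\ R 10%nat = 2 * (n * n2) + 4 /\
  forall r, R (16 + r)%nat = 0.

Arguments upd_reg f r v r' / : simpl nomatch.

Ltac wp_simpl :=
  cbn [wp app upd_reg Nat.eqb eval_binop read_sizes move_body before_fill fill_body
       clear_body Nat.add].

Lemma read_sizes_wp W n n2 M N X :
  X 0 = n -> X 1 = n2 -> X 3 = M -> 1 <= n -> 1 <= n2 -> 0 <= M ->
  N = (2 * M + 1) * n2 -> n <= N -> 20 * (N * N) + 20 < W ->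
  wp W read_sizes (fun R m => sizes_loaded n n2 N R /\ R 4%nat = 0 /\ m = X)
    (fun _ => 0) X.
Proof.
  intros X0 X1 X3 Hn Hn2 HM HN HnN HW.
  assert (M <= N) by nia. assert (n2 <= N) by nia.
  assert (n * n2 <= N * N) by nia. assert (0 < n * n2) by nia.
  assert (N <= N * N) by nia.
  wp_simpl.
  do 3 (split; [lia|]).
  intros v Hv v0 Hv0 v1 Hv1 v2 Hv2. split; [lia|].
  intros v3 Hv3. split; [lia|].
  intros v4 Hv4. assert (v4 = N) by (subst; ring). split; [lia|].
  intros v5 Hv5. assert (v5 = n * n2) by (subst; ring). split; [lia|].
  intros v6 Hv6. split; [lia|]. intros v7 Hv7. split; [lia|]. intros v8 Hv8.
  split; [lia|]. split; [lia|].
  split; [|split; reflexivity].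
  unfold sizes_loaded. wp_simpl. repeat split; congruence || lia.
Qed.

Definition move_inv (n n2 N : Z) (X : Z -> Z) (k : Z) (R : nat -> Z) (m : Z -> Z) : Prop :=
  sizes_loaded n n2 N R /\ R 4%nat = k /\
  forall a, m a = if a <? - k then 0 else if a <? 0 then X (- 1 - a)
                  else if a <? k then 0 else X a.

Ltac mem_cases :=
  unfold upd_mem;
  repeat match goal with
  | |- context [Z.eqb ?a ?b] => destruct (Z.eqb_spec a b)
  | |- context [Z.ltb ?a ?b] => destruct (Z.ltb_spec a b)
  end.

Ltac sizes_kept :=
  unfold sizes_loaded; wp_simpl; repeat split; try assumption; try reflexivity; try lia.

Lemma move_body_wp W n n2 N X k R m :
  20 * (N * N) + 20 < W -> n * n2 <= N * N -> 0 <= k < 2 * (n * n2) + 4 ->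
  move_inv n n2 N X k R m ->
  wp W (move_body ++ [Op Add 4 4 6])
    (fun R' m' => R' 4%nat = k + 1 /\ R' 10%nat = 2 * (n * n2) + 4 /\
                  move_inv n n2 N X (k + 1) R' m') R m.
Proof.
  intros HW Hnn Hk ((R0 & R1 & R3 & R6 & R8 & R9 & R10 & Rz) & R4 & Hm).
  pose proof (Z.square_nonneg N).
  wp_simpl. intros v Hv v0 Hv0. split; [lia|]. intros v1 Hv1. split; [lia|].
  intros v2 Hv2. split; [lia|]. split; [lia|]. split; [assumption|].
  unfold move_inv. split; [sizes_kept|]. split; [wp_simpl; lia|].
  wp_simpl. rewrite R4, R8. rewrite R4 in Hv. rewrite R4, R8 in Hv0. rewrite R6 in Hv1.
  intros a. rewrite Hm in Hv. subst v v0 v1. mem_cases; rewrite ?Hm; mem_cases;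
    try reflexivity; try lia; try (f_equal; lia).
Qed.

(** One formula serves all negative addresses: past the end of the input [X] is 0, and so are the
    cells below the moved copy. *)
Definition fill_inv (n n2 N : Z) (X : Z -> Z) (k : Z) (R : nat -> Z) (m : Z -> Z) : Prop :=
  sizes_loaded n n2 N R /\ R 5%nat = N * N /\ R 13%nat = -5 /\ R 4%nat = k /\
  forall a, m a = if a <? 0 then X (- 1 - a) else if a =? 0 then 0
    else if a <? 1 + k then left_cell n2 N X (a - 1)
    else if a <? 1 + N * N then 0
    else if a <? 1 + N * N + k then right_cell n n2 N X (a - 1 - N * N)
    else 0.

Lemma fill_body_wp W n n2 M N X k R m :
  1 <= n -> 1 <= n2 -> 0 <= M -> N = (2 * M + 1) * n2 -> n <= N ->
  20 * (N * N) + 20 < W -> (forall a, 4 <= a -> 0 <= X a <= M) ->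
  0 <= k < N * N -> fill_inv n n2 N X k R m ->
  wp W (fill_body ++ [Op Add 4 4 6])
    (fun R' m' => R' 4%nat = k + 1 /\ R' 5%nat = N * N /\
                  fill_inv n n2 N X (k + 1) R' m') R m.
Proof.
  intros Hn Hn2 HM HN HnN HW HX Hk
    ((R0 & R1 & R3 & R6 & R8 & R9 & R10 & Rz) & R5 & R13 & R4 & Hm).
  assert (HMN : M <= N) by nia. assert (Hn2N : n2 <= N) by nia.
  assert (Hnn : n * n2 <= N * N) by nia. assert (0 < n * n2) by nia.
  assert (N <= N * N) by nia.
  pose proof (Z.mod_pos_bound k N ltac:(lia)) as Hkm.
  assert (Hkd : 0 <= k / N < N)
    by (split; [apply Z.div_pos; lia | apply Z.div_lt_upper_bound; lia]).
  assert (Hvd : 0 <= k mod N / n2 <= N).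
  { split; [apply Z.div_pos; lia|]. apply Z.div_le_upper_bound; nia. }
  pose proof (Z.mod_pos_bound (k mod N) n2 ltac:(lia)) as Hvm.
  pose proof (Z.mod_pos_bound (k / N) n2 ltac:(lia)) as Hdm.
  wp_simpl. rewrite R0, R1, R3, R4, R5, R6, R9, R13.
  intros v Hv. split; [lia|]. intros v0 Hv0. split; [lia|].
  intros v1 Hv1. rewrite Hv0 in Hv1. split; [lia|].
  intros v2 Hv2. rewrite Hv0 in Hv2. split; [lia|].
  intros v3 Hv3. assert (0 <= v3 <= N * N) by (subst v v3; nia). split; [lia|].
  intros v4 Hv4. split; [lia|]. intros v5 Hv5. split; [lia|].
  intros v6 Hv6.
  (* The address read is negative, hence in the moved copy, which the loop never overwrites. *)
  assert (E6 : v6 = X (4 + (k / N * n2 + (k mod N) mod n2))).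
  { rewrite Hv6, Hm. destruct (Z.ltb_spec v5 0); [|lia]. f_equal. subst; ring. }
  assert (B6 : 0 <= v6 <= M) by (rewrite E6; apply HX; lia).
  intros v7 Hv7. assert (E7 : v7 = left_cell n2 N X k) by (unfold left_cell; congruence).
  split; [lia|]. intros v8 Hv8. split; [lia|].
  intros v9 Hv9. split; [lia|]. intros v10 Hv10. rewrite Hv9 in Hv10. split; [lia|].
  intros v11 Hv11. split; [lia|].
  intros v12 Hv12. assert (0 <= v12 <= n * n2) by (subst v10 v12; nia). split; [lia|].
  intros v13 Hv13. split; [lia|]. intros v14 Hv14. split; [lia|].
  intros v15 Hv15. split; [lia|]. intros v16 Hv16.
  assert (E16 : v16 = right_cell n n2 N X k).
  { rewrite Hv16. unfold upd_mem. destruct (Z.eqb_spec v15 v8); [lia|].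
    rewrite Hm. destruct (Z.ltb_spec v15 0); [|lia]. unfold right_cell. f_equal. subst; ring. }
  intros v17 Hv17. split; [lia|]. intros v18 Hv18. split; [lia|].
  split; [assumption|]. split; [reflexivity|].
  unfold fill_inv. wp_simpl. split; [sizes_kept|].
  split; [exact R5|]. split; [exact R13|]. split; [assumption|].
  clear Hv Hv0 Hv1 Hv2 Hv3 Hv4 Hv5 Hv6 E6 B6 Hv7 Hv9 Hv10 Hv11 Hv12 Hv13 Hv14 Hv15 Hv16 HN.
  intros a. subst v7 v16 v17 v8. mem_cases; rewrite ?Hm; mem_cases;
    try reflexivity; try lia; try (f_equal; lia).
Qed.

Definition clear_inv (n n2 N : Z) (X : Z -> Z) (k : Z) (R : nat -> Z) (m : Z -> Z) : Prop :=
  sizes_loaded n n2 N R /\ R 4%nat = k /\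
  forall a, m a = if a <? - k then X (- 1 - a) else if a =? 0 then 0
                  else prepared_mem n n2 N X a.

Lemma clear_body_wp W n n2 N X k R m :
  20 * (N * N) + 20 < W -> n * n2 <= N * N -> 0 <= k < 2 * (n * n2) + 4 ->
  clear_inv n n2 N X k R m ->
  wp W (clear_body ++ [Op Add 4 4 6])
    (fun R' m' => R' 4%nat = k + 1 /\ R' 10%nat = 2 * (n * n2) + 4 /\
                  clear_inv n n2 N X (k + 1) R' m') R m.
Proof.
  intros HW Hnn Hk ((R0 & R1 & R3 & R6 & R8 & R9 & R10 & Rz) & R4 & Hm).
  pose proof (Z.square_nonneg N).
  wp_simpl. intros v0 Hv0. split; [lia|]. intros v1 Hv1. split; [lia|].
  intros v2 Hv2. split; [lia|]. split; [lia|]. split; [assumption|].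
  unfold clear_inv. split; [sizes_kept|]. split; [wp_simpl; lia|].
  wp_simpl. rewrite R8. rewrite R4, R8 in Hv0. rewrite R6 in Hv1.
  intros a. subst v0 v1. unfold prepared_mem in *. mem_cases; rewrite ?Hm; mem_cases;
    try reflexivity; try lia.
Qed.

(** Moving and clearing cost 7 and 5 steps for each of the [2 * (n * n2) + 4] input cells, filling
    costs 23 for each of [N * N] entries, and 19 steps lie outside the loops. With [n * n2 <= N * N]
    the total stays below [120 * (N * N)]. *)
Lemma prepare_reaches P w n n2 M N X :
  code_at P 0 prepare -> fits w (State 0 (fun _ => 0) X) ->
  X 0 = n -> X 1 = n2 -> X 3 = M -> 1 <= n -> 1 <= n2 -> 0 <= M ->
  N = (2 * M + 1) * n2 -> n <= N -> 20 * (N * N) + 20 < 2 ^ Z.of_nat w ->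
  (forall a, 4 <= a -> 0 <= X a <= M) ->
  (forall a, a < 0 \/ 2 * (n * n2) + 4 <= a -> X a = 0) ->
  exists t R m, Z.of_nat t <= 120 * (N * N) /\
    reaches P w t (State 0 (fun _ => 0) X) (State (length prepare) R m) /\
    sizes_loaded n n2 N R /\ forall a, m a = prepared_mem n n2 N X a.
Proof.
  intros Hc Hf X0 X1 X3 Hn Hn2 HM HN HnN HW HX HXz.
  assert (n2 <= N) by nia.
  assert (Hnn : n * n2 <= N * N) by nia. assert (0 < n * n2) by nia.
  assert (N <= N * N) by nia.
  unfold prepare in Hc.
  apply code_at_app in Hc. destruct Hc as [C1 Hc].
  apply code_at_app in Hc. destruct Hc as [C2 Hc].
  apply code_at_app in Hc. destruct Hc as [C3 Hc].
  apply code_at_app in Hc. destruct Hc as [C4 Hc].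
  apply code_at_app in Hc. destruct Hc as [C5 Hc].
  apply code_at_app in Hc. destruct Hc as [C6 C7].
  cbn [length Nat.add read_sizes loop move_body before_fill fill_body clear_body app] in *.
  destruct (wp_reaches P w _ _ _ _ _ C1 Hf (read_sizes_wp _ n n2 M N X X0 X1 X3 Hn Hn2 HM HN HnN HW))
    as (R1 & m1 & Hr1 & HS1 & Hcnt1 & Hm1).
  cbn [length Nat.add read_sizes] in Hr1.
  destruct (loop_reaches P w 14 move_body 4 10 6 (move_inv n n2 N X) (2 * (n * n2) + 4)
              C2 (fun k R m Hk => move_body_wp _ n n2 N X k R m HW Hnn Hk) ltac:(lia)
              R1 m1 (reaches_fits_end _ _ _ _ _ Hr1))
    as (t2 & R2 & m2 & Ht2 & Hr2 & HS2 & Hcnt2 & Hm2).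
  { split; [exact HS1|]. split; [exact Hcnt1|]. intros a. subst m1.
    mem_cases; try lia; try reflexivity. apply HXz; lia. }
  cbn [length Nat.add move_body] in Hr2, Ht2.
  destruct (wp_reaches P w _ (fill_inv n n2 N X 0) _ _ _ C3 (reaches_fits_end _ _ _ _ _ Hr2))
    as (R3 & m3 & Hr3 & HI3).
  { destruct HS2 as (R0 & R1' & R3 & R6 & R8 & R9 & R10 & Rz).
    wp_simpl. rewrite R3. intros v Hv. split; [lia|]. split; [lia|]. split; [lia|].
    split; [sizes_kept|]. wp_simpl. repeat (split; [assumption || reflexivity|]).
    intros a. rewrite Hm2. mem_cases; try lia; try reflexivity; symmetry + idtac; apply HXz; lia. }
  cbn [length Nat.add] in Hr3.
  destruct (loop_reaches P w 24 fill_body 4 5 6 (fill_inv n n2 N X) (N * N)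
              C4 (fun k R m Hk => fill_body_wp _ n n2 M N X k R m Hn Hn2 HM HN HnN HW HX Hk)
              ltac:(lia) R3 m3 (reaches_fits_end _ _ _ _ _ Hr3) HI3)
    as (t4 & R4 & m4 & Ht4 & Hr4 & HS4 & _ & _ & _ & Hm4).
  cbn [length Nat.add fill_body] in Hr4, Ht4.
  destruct (wp_reaches P w _ (clear_inv n n2 N X 0) _ _ _ C5 (reaches_fits_end _ _ _ _ _ Hr4))
    as (R5 & m5 & Hr5 & HI5).
  { destruct HS4 as (R0 & R1' & R3' & R6 & R8 & R9 & R10 & Rz).
    wp_simpl. split; [lia|]. split; [sizes_kept|]. split; [reflexivity|].
    intros a. rewrite Hm4. unfold prepared_mem. mem_cases; try lia; reflexivity. }
  cbn [length Nat.add] in Hr5.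
  destruct (loop_reaches P w 48 clear_body 4 10 6 (clear_inv n n2 N X) (2 * (n * n2) + 4)
              C6 (fun k R m Hk => clear_body_wp _ n n2 N X k R m HW Hnn Hk) ltac:(lia)
              R5 m5 (reaches_fits_end _ _ _ _ _ Hr5) HI5)
    as (t6 & R6 & m6 & Ht6 & Hr6 & HS6 & _ & Hm6).
  cbn [length Nat.add clear_body] in Hr6, Ht6.
  destruct (wp_reaches P w _ (fun R m => sizes_loaded n n2 N R /\
              forall a, m a = prepared_mem n n2 N X a) _ _ _ C7 (reaches_fits_end _ _ _ _ _ Hr6))
    as (R7 & m7 & Hr7 & HS7 & Hm7).
  { wp_simpl. split; [exact HS6|].
    destruct HS6 as (R0 & R1' & R3' & R6' & R8 & R9 & R10 & Rz).
    intros a. rewrite R8, R3'. unfold upd_mem. rewrite Hm6. unfold prepared_mem.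
    mem_cases; try lia; try reflexivity. apply HXz; lia. }
  cbn [length Nat.add] in Hr7.
  exists (14 + (t2 + (3 + (t4 + (1 + (t6 + 1))))))%nat, R7, m7.
  split; [lia|]. split; [|auto].
  exact (reaches_trans _ _ _ _ _ _ _ Hr1 (reaches_trans _ _ _ _ _ _ _ Hr2
    (reaches_trans _ _ _ _ _ _ _ Hr3 (reaches_trans _ _ _ _ _ _ _ Hr4
    (reaches_trans _ _ _ _ _ _ _ Hr5 (reaches_trans _ _ _ _ _ _ _ Hr6 Hr7)))))).
Qed.

(** * Reading the Min-Plus entries off the witnesses *)

Definition extract_body : list instr :=
  [ Op Div 11 4 0; Op Mod 12 4 0; Op Mul 11 11 3; Op Add 11 11 12; Read 11 11;
    Op Sub 11 11 6; Op Div 11 11 1; Write 4 11 ].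

Definition extract (b : nat) : list instr :=
  [ Const 4 0; Op Mul 5 0 0 ] ++ loop (b + 2) extract_body 4 5 6.

(** Subtracting 1 undoes the numbering of witnesses from 1; dividing by [n2] then drops [k] from the
    index [v * n2 + k]. *)
Definition extracted (n n2 N : Z) (Y : Z -> Z) (a : Z) : Z :=
  (Y (a / n * N + a mod n) - 1) / n2.

(* The cell read in round [a] is at address at least [a], so writing in place is safe. *)
Lemma extract_reaches P w b R Y n n2 N :
  code_at P b (extract b) -> fits w (State b R Y) ->
  R 0%nat = n -> R 1%nat = n2 -> R 3%nat = N -> R 6%nat = 1 ->
  1 <= n -> 1 <= n2 -> n <= N -> N * N + N < 2 ^ Z.of_nat w ->
  (forall i j, 0 <= i < n -> 0 <= j < n -> 1 <= Y (i * N + j) <= N) ->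
  exists t R' m, Z.of_nat t <= 12 * (N * N) /\
    reaches P w t (State b R Y) (State (b + length (extract b)) R' m) /\
    forall a, 0 <= a < n * n -> m a = extracted n n2 N Y a.
Proof.
  intros Hc Hf R0 R1 R3 R6 Hn Hn2 HnN HW HY.
  assert (n * n <= N * N) by nia.
  unfold extract in *. apply code_at_app in Hc. destruct Hc as [C1 C2]. cbn [length] in C2.
  set (Inv := fun k (R : nat -> Z) (m : Z -> Z) =>
    R 0%nat = n /\ R 1%nat = n2 /\ R 3%nat = N /\ R 6%nat = 1 /\ R 5%nat = n * n /\
    R 4%nat = k /\
    forall a, 0 <= a -> m a = if a <? k then extracted n n2 N Y a else Y a).
  destruct (wp_reaches P w _ (Inv 0) _ _ _ C1 Hf) as (R' & m' & Hr1 & HI).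
  { wp_simpl. rewrite R0. split; [lia|]. intros v Hv. split; [nia|].
    unfold Inv. wp_simpl. repeat (split; [assumption || reflexivity|]).
    intros a Ha. mem_cases; [lia | reflexivity]. }
  cbn [length] in Hr1.
  destruct (loop_reaches P w (b + 2) extract_body 4 5 6 Inv (n * n) C2) with (R := R') (m := m')
    as (t & R2 & m2 & Ht & Hr2 & HI2).
  - clear R Hf R0 R1 R3 R6 Hr1 HI. intros k R m Hk (R0 & R1 & R3 & R6 & R5 & R4 & Hm).
    pose proof (Z.mod_pos_bound k n ltac:(lia)) as Hkm.
    assert (Hkd : 0 <= k / n < n)
      by (split; [apply Z.div_pos; lia | apply Z.div_lt_upper_bound; lia]).
    pose proof (Z.div_mod k n ltac:(lia)) as Hdm.
    unfold extract_body. wp_simpl. rewrite R0, R1, R3, R4, R5, R6.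
    intros v Hv. split; [nia|]. intros v0 Hv0. split; [nia|].
    intros v1 Hv1. assert (k / n * n <= v1 <= N * N) by (subst; nia). split; [nia|].
    intros v2 Hv2. split; [nia|].
    intros v3 Hv3. rewrite Hm in Hv3 by nia.
    destruct (Z.ltb_spec v2 k); [nia|].
    assert (E3 : v3 = Y (k / n * N + k mod n)) by (rewrite Hv3; f_equal; congruence).
    pose proof (HY _ _ Hkd Hkm) as HYk. rewrite <- E3 in HYk.
    intros v4 Hv4. split; [nia|].
    intros v5 Hv5.
    assert (0 <= v5 <= N)
      by (subst v5; split; [apply Z.div_pos; lia | apply Z.div_le_upper_bound; nia]).
    split; [nia|]. intros v6 Hv6. split; [nia|]. split; [assumption|]. split; [reflexivity|].
    unfold Inv. wp_simpl. repeat (split; [assumption || reflexivity|]).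
    assert (E5 : v5 = extracted n n2 N Y k) by (unfold extracted; congruence).
    clear - E5 Hm Hk. intros a Ha. mem_cases; rewrite ?Hm by exact Ha; mem_cases;
      try lia; try reflexivity. congruence.
  - nia.
  - exact (reaches_fits_end _ _ _ _ _ Hr1).
  - exact HI.
  - exists (2 + t)%nat, R2, m2. cbn [length extract_body] in Ht. split; [nia|]. split.
    + rewrite length_app, loop_length. cbn [length]. rewrite Nat.add_assoc.
      exact (reaches_trans _ _ _ _ _ _ _ Hr1 Hr2).
    + destruct HI2 as (_ & _ & _ & _ & _ & _ & Hm). intros a Ha. rewrite Hm by lia.
      destruct (Z.ltb_spec a (n * n)); [reflexivity | lia].
Qed.

(** * The Min-Plus input in memory and the lifted instance *)

Lemma encode_pair_length lo hi n1 n2 n3 (x : matrix_pair lo hi n1 n2 n3) :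
  length (encode_pair x) = (n1 * n2 + n2 * n3)%nat.
Proof. unfold encode_pair. rewrite length_app, !row_major_length. reflexivity. Qed.

Lemma nth_encode_pair_left lo hi n1 n2 n3 (x : matrix_pair lo hi n1 n2 n3) i k :
  (i < n1)%nat -> (k < n2)%nat -> nth (i * n2 + k) (encode_pair x) 0 = matA x i k.
Proof.
  intros Hi Hk. unfold encode_pair.
  rewrite app_nth1 by (rewrite row_major_length; nia). apply nth_row_major; assumption.
Qed.

Lemma nth_encode_pair_right lo hi n1 n2 n3 (x : matrix_pair lo hi n1 n2 n3) k j :
  (k < n2)%nat -> (j < n3)%nat ->
  nth (n1 * n2 + (k * n3 + j)) (encode_pair x) 0 = matB x k j.
Proof.
  intros Hk Hj. unfold encode_pair.
  rewrite app_nth2; rewrite row_major_length; [|lia].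
  replace (n1 * n2 + (k * n3 + j) - n1 * n2)%nat with (k * n3 + j)%nat by lia.
  apply nth_row_major; assumption.
Qed.

Lemma Forall_encode_pair (P : Z -> Prop) lo hi n1 n2 n3 (x : matrix_pair lo hi n1 n2 n3) :
  (forall v, lo <= v <= hi -> P v) -> Forall P (encode_pair x).
Proof.
  intros H. apply Forall_app. split; apply Forall_row_major; intros i j Hi Hj; apply H;
    [apply (matA_in _ _ _ _ _ x) | apply (matB_in _ _ _ _ _ x)]; assumption.
Qed.

Definition min_plus_input {M : Z} {n n2 : nat} (x : matrix_pair 0 M n n2 n) : list Z :=
  [Z.of_nat n; Z.of_nat n2; Z.of_nat n; M] ++ encode_pair x.

Lemma mem_min_plus_input M n n2 (x : matrix_pair 0 M n n2 n) k :
  mem (init (min_plus_input x)) (4 + Z.of_nat k) = nth k (encode_pair x) 0.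
Proof. change 4 with (Z.of_nat 4). rewrite <- Nat2Z.inj_add, mem_init. reflexivity. Qed.

Lemma mem_min_plus_input_bounds M n n2 (x : matrix_pair 0 M n n2 n) a :
  0 <= M -> 4 <= a -> 0 <= mem (init (min_plus_input x)) a <= M.
Proof.
  intros HM Ha. replace a with (4 + Z.of_nat (Z.to_nat (a - 4))) by lia.
  rewrite mem_min_plus_input.
  destruct (Nat.lt_ge_cases (Z.to_nat (a - 4)) (length (encode_pair x))) as [Hl|Hl].
  - assert (H : Forall (fun v => 0 <= v <= M) (encode_pair x))
      by (apply Forall_encode_pair; auto).
    rewrite Forall_forall in H. apply H, nth_In, Hl.
  - rewrite nth_overflow by exact Hl. lia.
Qed.

Lemma mem_min_plus_input_outside M n n2 (x : matrix_pair 0 M n n2 n) a :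
  a < 0 \/ 2 * (Z.of_nat n * Z.of_nat n2) + 4 <= a -> mem (init (min_plus_input x)) a = 0.
Proof.
  intros Ha. destruct (Z.lt_ge_cases a 0) as [H|H].
  - cbn. destruct (Z.ltb_spec a 0); [reflexivity | lia].
  - replace a with (4 + Z.of_nat (Z.to_nat (a - 4))) by lia.
    rewrite mem_min_plus_input. apply nth_overflow. rewrite encode_pair_length. nia.
Qed.

Lemma fits_min_plus_input w M n n2 (x : matrix_pair 0 M n n2 n) : 0 <= M ->
  Z.of_nat n < 2 ^ Z.of_nat w -> Z.of_nat n2 < 2 ^ Z.of_nat w -> M < 2 ^ Z.of_nat w ->
  fits w (init (min_plus_input x)).
Proof.
  intros. apply fits_init. unfold min_plus_input. apply Forall_app. split.
  - repeat constructor; lia.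
  - apply Forall_encode_pair. lia.
Qed.

(** The inner index [v * n2 + k] stands for the claim [A i k + B k j = v]. *)
Definition lifted_left (n2 N : Z) (X : Z -> Z) : matrix :=
  fun i k => left_cell n2 N X (Z.of_nat i * N + Z.of_nat k).

Definition lifted_right (n n2 N : Z) (X : Z -> Z) : matrix :=
  fun k j => right_cell n n2 N X (Z.of_nat k * N + Z.of_nat j).

Lemma div_mod_row N i j : 0 <= j < N -> (i * N + j) / N = i /\ (i * N + j) mod N = j.
Proof.
  intros H. split.
  - rewrite Z.div_add_l by lia. rewrite Z.div_small by lia. lia.
  - rewrite Z.add_comm, Z.mod_add by lia. apply Z.mod_small; lia.
Qed.

Lemma lifted_left_eq M n n2 N (x : matrix_pair 0 M n n2 n) i k :
  (i < n)%nat -> (k < N)%nat -> (0 < n2)%nat ->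
  lifted_left (Z.of_nat n2) (Z.of_nat N) (mem (init (min_plus_input x))) i k =
  Z.of_nat k / Z.of_nat n2 - matA x i (k mod n2)%nat.
Proof.
  intros Hi Hk Hn2. unfold lifted_left, left_cell.
  destruct (div_mod_row (Z.of_nat N) (Z.of_nat i) (Z.of_nat k) ltac:(lia)) as [-> ->].
  rewrite <- Nat2Z.inj_mod, <- Nat2Z.inj_mul, <- Nat2Z.inj_add, mem_min_plus_input.
  rewrite nth_encode_pair_left; [reflexivity | exact Hi | apply Nat.mod_upper_bound; lia].
Qed.

Lemma lifted_right_eq M n n2 N (x : matrix_pair 0 M n n2 n) k j :
  (j < n)%nat -> (n <= N)%nat -> (0 < n2)%nat ->
  lifted_right (Z.of_nat n) (Z.of_nat n2) (Z.of_nat N) (mem (init (min_plus_input x))) k j =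
  matB x (k mod n2)%nat j.
Proof.
  intros Hj HnN Hn2. unfold lifted_right, right_cell.
  destruct (div_mod_row (Z.of_nat N) (Z.of_nat k) (Z.of_nat j) ltac:(lia)) as [-> ->].
  rewrite <- Nat2Z.inj_mod, <- !Nat2Z.inj_mul, <- !Nat2Z.inj_add, mem_min_plus_input.
  rewrite Nat.add_comm.
  apply nth_encode_pair_right; [apply Nat.mod_upper_bound; lia | exact Hj].
Qed.

Lemma lifted_left_bounds M n n2 N (x : matrix_pair 0 M n n2 n) i k :
  0 <= M -> 1 <= Z.of_nat n2 -> N = (2 * M + 1) * Z.of_nat n2 -> Z.of_nat k < N ->
  - N <= lifted_left (Z.of_nat n2) N (mem (init (min_plus_input x))) i k <= N.
Proof.
  intros HM Hn2 HN Hk. unfold lifted_left, left_cell.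
  destruct (div_mod_row N (Z.of_nat i) (Z.of_nat k) ltac:(lia)) as [-> ->].
  pose proof (Z.mod_pos_bound (Z.of_nat k) (Z.of_nat n2) ltac:(lia)).
  pose proof (mem_min_plus_input_bounds M n _ x
    (4 + (Z.of_nat i * Z.of_nat n2 + Z.of_nat k mod Z.of_nat n2)) HM ltac:(nia)).
  assert (0 <= Z.of_nat k / Z.of_nat n2 <= N)
    by (split; [apply Z.div_pos; lia | apply Z.div_le_upper_bound; nia]).
  nia.
Qed.

Lemma lifted_right_bounds M n n2 N (x : matrix_pair 0 M n n2 n) k j :
  0 <= M -> 1 <= Z.of_nat n2 -> N = (2 * M + 1) * Z.of_nat n2 -> Z.of_nat j < N ->
  - N <= lifted_right (Z.of_nat n) (Z.of_nat n2) N (mem (init (min_plus_input x))) k j <= N.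
Proof.
  intros HM Hn2 HN Hj. unfold lifted_right, right_cell.
  destruct (div_mod_row N (Z.of_nat k) (Z.of_nat j) ltac:(lia)) as [-> ->].
  pose proof (Z.mod_pos_bound (Z.of_nat k) (Z.of_nat n2) ltac:(lia)).
  pose proof (mem_min_plus_input_bounds M n _ x
    (4 + ((Z.of_nat k mod Z.of_nat n2) * Z.of_nat n + Z.of_nat j + Z.of_nat n * Z.of_nat n2))
    HM ltac:(nia)).
  nia.
Qed.

(** Each [k] supplies a witness whose quotient by [n2] is its own sum, so the answer is never the
    code 0 of the empty set, and the quotient of the least witness is at most every sum. It is
    itself a sum because the least witness is an equality. *)
Lemma min_plus_of_min_witness n n2 N M (A B L E C : matrix) i j :
  (0 < n2)%nat -> N = ((2 * M + 1) * n2)%nat -> (i < n)%nat -> (j < n)%nat -> (n <= N)%nat ->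
  entries_in 0 (Z.of_nat M) n n2 A -> entries_in 0 (Z.of_nat M) n2 n B ->
  (forall k, (k < N)%nat -> L i k = Z.of_nat k / Z.of_nat n2 - A i (k mod n2)%nat) ->
  (forall k, (k < N)%nat -> E k j = B (k mod n2)%nat j) ->
  is_min_witness N L E C ->
  1 <= C i j <= Z.of_nat N /\
  (exists k, (k < n2)%nat /\ (C i j - 1) / Z.of_nat n2 = A i k + B k j) /\
  (forall k, (k < n2)%nat -> (C i j - 1) / Z.of_nat n2 <= A i k + B k j).
Proof.
  intros Hn2 HN Hi Hj HnN HA HB HL HE HC.
  assert (Hwit : forall k, (k < n2)%nat ->
            exists q, (q < N)%nat /\ L i q = E q j /\
                      Z.of_nat q / Z.of_nat n2 = A i k + B k j).
  { intros k Hk. pose proof (HA i k Hi Hk). pose proof (HB k j Hk Hj).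
    (* This is the pair [(v, k)] with [v] the sum itself; it lies below [N] because [v <= 2 * M]. *)
    exists (Z.to_nat (A i k + B k j) * n2 + k)%nat.
    assert (Hq : (Z.to_nat (A i k + B k j) * n2 + k < N)%nat) by nia.
    assert (Hm : ((Z.to_nat (A i k + B k j) * n2 + k) mod n2 = k)%nat).
    { rewrite Nat.add_comm, Nat.Div0.mod_add. apply Nat.mod_small, Hk. }
    assert (Hd : Z.of_nat (Z.to_nat (A i k + B k j) * n2 + k) / Z.of_nat n2 = A i k + B k j).
    { rewrite Nat2Z.inj_add, Nat2Z.inj_mul, Z2Nat.id by lia.
      apply div_mod_row. lia. }
    split; [exact Hq|]. rewrite HL, HE, Hm, Hd by exact Hq. lia. }
  destruct (HC i j ltac:(lia) ltac:(lia)) as [(q & Hq & Heq & Hmin & HCq) | [Hnone _]].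
  - rewrite HCq. replace (Z.of_nat (S q) - 1) with (Z.of_nat q) by lia.
    split; [lia|]. split.
    + exists (q mod n2)%nat. split; [apply Nat.mod_upper_bound; lia|].
      rewrite HL, HE in Heq by exact Hq. lia.
    + intros k Hk. destruct (Hwit k Hk) as (q' & Hq' & Heq' & <-).
      apply Z.div_le_mono; [lia|]. apply inj_le, Hmin; assumption.
  - exfalso. destruct (Hwit 0%nat Hn2) as (q & Hq & Heq & _). exact (Hnone q Hq Heq).
Qed.

(** This lets the embedded program start from a genuine initial state: the memory left by [prepare]
    agrees with it at every address, negative ones included. *)
Lemma prepared_mem_init n n2 N X a :
  mem (init (Z.of_nat N :: row_major N N (lifted_left n2 (Z.of_nat N) X) ++
                           row_major N N (lifted_right n n2 (Z.of_nat N) X))) a =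
  prepared_mem n n2 (Z.of_nat N) X a.
Proof.
  unfold prepared_mem. destruct (Z.ltb_spec a 0) as [H|H].
  { cbn. destruct (Z.ltb_spec a 0); [reflexivity | lia]. }
  replace a with (Z.of_nat (Z.to_nat a)) at 1 by lia. rewrite mem_init.
  destruct (Z.eqb_spec a 0) as [H0|H0]; [subst a; reflexivity|].
  replace (Z.to_nat a) with (S (Z.to_nat (a - 1))) by lia. cbn [nth].
  assert (Hidx : forall b, (b < N * N)%nat ->
    exists i j, (i < N)%nat /\ (j < N)%nat /\ b = (i * N + j)%nat).
  { intros b Hb. exists (b / N)%nat, (b mod N)%nat. assert (N <> 0)%nat by nia. split.
    - apply Nat.Div0.div_lt_upper_bound. lia.
    - split; [apply Nat.mod_upper_bound; lia|]. rewrite Nat.mul_comm. apply Nat.div_mod_eq. }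
  destruct (Z.ltb_spec a (1 + Z.of_nat N * Z.of_nat N)) as [H1|H1].
  { rewrite app_nth1 by (rewrite row_major_length; nia).
    destruct (Hidx (Z.to_nat (a - 1))) as (i & j & Hi & Hj & E); [nia|].
    rewrite E, nth_row_major by assumption. unfold lifted_left. f_equal. nia. }
  rewrite app_nth2; rewrite row_major_length; [|nia].
  destruct (Z.ltb_spec a (1 + Z.of_nat N * Z.of_nat N + Z.of_nat N * Z.of_nat N)) as [H2|H2].
  - destruct (Hidx (Z.to_nat (a - 1) - N * N)%nat) as (i & j & Hi & Hj & E); [nia|].
    rewrite E, nth_row_major by assumption. unfold lifted_right. f_equal. nia.
  - apply nth_overflow. rewrite row_major_length. nia.
Qed.

Definition reduce (p : program) : program :=
  prepare ++ relocate (length prepare) p ++ extract (length prepare + length p).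

(** The overhead 133 is 120 for the preparation, 12 for the extraction and 1 for the jump replacing
    [Halt]. *)
Lemma reduce_correct p w t (n n2 N M : nat) (x : matrix_pair 0 (Z.of_nat M) n n2 n) :
  let X := mem (init (min_plus_input x)) in
  let L := lifted_left (Z.of_nat n2) (Z.of_nat N) X in
  let E := lifted_right (Z.of_nat n) (Z.of_nat n2) (Z.of_nat N) X in
  let s := init (Z.of_nat N :: row_major N N L ++ row_major N N E) in
  (1 <= n)%nat -> (1 <= n2)%nat -> N = ((2 * M + 1) * n2)%nat -> (n <= N)%nat ->
  20 * (Z.of_nat N * Z.of_nat N) + 20 < 2 ^ Z.of_nat w ->
  (forall u, fits w (run p u s)) -> halted p (run p t s) ->
  is_min_witness N L E (matrix_of_cells N (fun i => mem (run p t s) (Z.of_nat i))) ->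
  (forall u, fits w (run (reduce p) u (init (min_plus_input x)))) /\
  exists t', (t' <= t + 133 * (N * N))%nat /\
    halted (reduce p) (run (reduce p) t' (init (min_plus_input x))) /\
    is_min_plus n n2 n (matA x) (matB x)
      (matrix_of_cells n
         (fun i => mem (run (reduce p) t' (init (min_plus_input x))) (Z.of_nat i))).
Proof.
  intros X L E s Hn Hn2 HN HnN HW Hfits Hhalt Hwit.
  assert (HMN : (M <= N)%nat) by nia. assert (Hn2N : (n2 <= N)%nat) by nia.
  assert (HNN : Z.of_nat N <= Z.of_nat N * Z.of_nat N) by nia.
  assert (Hf0 : fits w (init (min_plus_input x))) by (apply fits_min_plus_input; lia).
  pose proof (code_at_0 (reduce p)) as Hc. unfold reduce in Hc at 2.
  apply code_at_app in Hc. destruct Hc as [C1 Hc].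
  apply code_at_app in Hc. destruct Hc as [C2 C3].
  rewrite Nat.add_0_l in C2, C3. unfold relocate in C3 at 1. rewrite length_map in C3.
  destruct (prepare_reaches (reduce p) w (Z.of_nat n) (Z.of_nat n2) (Z.of_nat M) (Z.of_nat N) X C1 Hf0)
    as (t1 & R1 & m1 & Ht1 & Hr1 & (R0 & R1' & R3 & R6 & _ & _ & _ & Rz) & Hm1);
    try reflexivity; try lia.
  { intros a Ha. apply mem_min_plus_input_bounds; lia. }
  { apply mem_min_plus_input_outside. }
  destruct (relocate_reaches (reduce p) w (length prepare) p R1 C2) with
    (t := t) (s := s) (s' := State (length prepare) R1 m1)
    as (t2 & s2 & Ht2 & Hr2 & Hpc2 & Hm2 & HR2).
  { intros r _. apply (reaches_fits_end _ _ _ _ _ Hr1). }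
  { split; [cbn [pc init s]; lia|]. split; [intros r; apply Rz|].
    split; [|reflexivity]. intros a. cbn [mem]. rewrite Hm1. symmetry. apply prepared_mem_init. }
  { exact Hfits. }
  { exact Hhalt. }
  destruct s2 as [pc2 R2 Y]. cbn [pc regs mem] in Hpc2, Hm2, HR2. subst pc2.
  assert (HY : forall i j, (i < n)%nat -> (j < n)%nat ->
    1 <= Y (Z.of_nat i * Z.of_nat N + Z.of_nat j) <= Z.of_nat N /\
    (exists k, (k < n2)%nat /\
       (Y (Z.of_nat i * Z.of_nat N + Z.of_nat j) - 1) / Z.of_nat n2 = matA x i k + matB x k j) /\
    (forall k, (k < n2)%nat ->
       (Y (Z.of_nat i * Z.of_nat N + Z.of_nat j) - 1) / Z.of_nat n2 <= matA x i k + matB x k j)).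
  { intros i j Hi Hj. rewrite Hm2.
    pose proof (min_plus_of_min_witness n n2 N M (matA x) (matB x) L E _ i j Hn2 HN Hi Hj HnN
      (matA_in _ _ _ _ _ x) (matB_in _ _ _ _ _ x)
      (fun k Hk => lifted_left_eq _ n n2 N x i k Hi Hk Hn2)
      (fun k _ => lifted_right_eq _ n n2 N x k j Hj HnN Hn2) Hwit) as H.
    unfold matrix_of_cells in H. rewrite Nat2Z.inj_add, Nat2Z.inj_mul in H. exact H. }
  destruct (extract_reaches (reduce p) w _ R2 Y (Z.of_nat n) (Z.of_nat n2) (Z.of_nat N) C3
      (reaches_fits_end _ _ _ _ _ Hr2)) as (t3 & R' & m & Ht3 & Hr3 & Hm3);
    try (rewrite HR2 by lia; assumption); try lia.
  { intros i j Hi Hj. destruct (HY (Z.to_nat i) (Z.to_nat j)) as [H _]; [lia | lia |].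
    rewrite !Z2Nat.id in H by lia. exact H. }
  pose proof (reaches_trans _ _ _ _ _ _ _ Hr1 (reaches_trans _ _ _ _ _ _ _ Hr2 Hr3)) as Hr.
  assert (Hh : halted (reduce p) (run (reduce p) (t1 + (t2 + t3)) (init (min_plus_input x)))).
  (* [reduce] halts by running off its end. *)
  { rewrite (proj1 Hr : run _ _ (init (min_plus_input x)) = _). left. apply nth_error_None. cbn [pc]. unfold reduce.
    rewrite !length_app. unfold relocate. rewrite length_map. lia. }
  split.
  - eapply reaches_halted_fits; [exact Hr|].
    rewrite <- (proj1 Hr : run _ _ (init (min_plus_input x)) = _). exact Hh.
  - exists (t1 + (t2 + t3))%nat. split; [nia|]. split; [exact Hh|].
    rewrite (proj1 Hr : run _ _ (init (min_plus_input x)) = _). intros i j Hi Hj. cbn [mem]. unfold matrix_of_cells.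
    rewrite Hm3 by nia. unfold extracted.
    rewrite Nat2Z.inj_add, Nat2Z.inj_mul.
    destruct (div_mod_row (Z.of_nat n) (Z.of_nat i) (Z.of_nat j) ltac:(lia)) as [-> ->].
    apply (HY i j Hi Hj).
Qed.

(** * Inner dimension above the outer one *)

(** Writing the constant 0 would fail at [n = 1], where [n^(1-rho)] is 1 and entries may be 1. The
    sum [A 0 0 + B 0 0] covers both situations: it is 0 when [M = 0], and the only sum when
    [n = n2 = 1]. Its terms are in cells [4] and [n * n2 + 4]. *)
Definition broadcast : program :=
  [ Const 6 1; Const 7 4; Const 8 0; Read 0 8; Read 1 6; Op Mul 9 0 1; Op Add 9 9 7;
    Read 10 9; Read 11 7; Op Add 10 10 11; Op Mul 5 0 0; Const 4 0 ] ++
  loop 12 [Write 4 10] 4 5 6.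

Lemma broadcast_reaches w n n2 v X :
  fits w (State 0 (fun _ => 0) X) -> X 0 = n -> X 1 = n2 -> X (n * n2 + 4) + X 4 = v ->
  Z.abs v < 2 ^ Z.of_nat w -> 1 <= n -> 1 <= n2 ->
  n * n2 + n * n + 5 < 2 ^ Z.of_nat w ->
  exists t R m, Z.of_nat t <= 15 * (n * n) /\
    reaches broadcast w t (State 0 (fun _ => 0) X) (State 15 R m) /\
    forall a, 0 <= a < n * n -> m a = v.
Proof.
  intros Hf X0 X1 Xv Hv Hn Hn2 HW.
  assert (0 < n * n2) by nia. assert (0 < n * n) by nia.
  pose proof (code_at_0 broadcast) as Hc. unfold broadcast in Hc at 2.
  apply code_at_app in Hc. destruct Hc as [C1 C2].
  set (Inv := fun k (R : nat -> Z) (m : Z -> Z) =>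
    R 6%nat = 1 /\ R 10%nat = v /\ R 5%nat = n * n /\ R 4%nat = k /\
    forall a, 0 <= a < k -> m a = v).
  destruct (wp_reaches _ w _ (Inv 0) _ _ _ C1 Hf) as (R' & m' & Hr1 & HI).
  { wp_simpl. do 3 (split; [lia|]). intros v0 Hv0 v1 Hv1.
    rewrite X0 in Hv0. rewrite X1 in Hv1. subst v0 v1.
    intros v2 Hv2. split; [lia|]. intros v3 Hv3. split; [lia|].
    intros v4 Hv4 v5 Hv5 v6 Hv6. assert (v6 = v) by (subst v6 v5 v4 v3 v2; exact Xv).
    split; [lia|]. intros v7 Hv7. split; [lia|]. split; [lia|].
    unfold Inv. wp_simpl. repeat (split; [assumption || reflexivity|]). lia. }
  destruct (loop_reaches broadcast w 12 [Write 4 10] 4 5 6 Inv (n * n) C2)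
    with (R := R') (m := m') as (t & R2 & m2 & Ht & Hr2 & HI2).
  - intros k R m Hk (R6 & R10 & R5 & R4 & Hm).
    wp_simpl. rewrite R4, R5, R6, R10. intros v0 Hv0. split; [lia|].
    split; [assumption|]. split; [reflexivity|].
    unfold Inv. wp_simpl. repeat (split; [assumption || reflexivity|]).
    intros a Ha. unfold upd_mem. destruct (Z.eqb_spec a k); [reflexivity | apply Hm; lia].
  - lia.
  - exact (reaches_fits_end _ _ _ _ _ Hr1).
  - exact HI.
  - exists (12 + t)%nat, R2, m2. cbn [length] in Ht. split; [lia|]. split.
    + exact (reaches_trans _ _ _ _ _ _ _ Hr1 Hr2).
    + apply HI2.
Qed.

Lemma broadcast_correct w (n n2 M : nat) (x : matrix_pair 0 (Z.of_nat M) n n2 n) :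
  (1 <= n)%nat -> (1 <= n2)%nat -> (M = 0 \/ n = 1 /\ n2 = 1)%nat ->
  2 * Z.of_nat M + Z.of_nat n * Z.of_nat n2 + Z.of_nat n * Z.of_nat n + 5 < 2 ^ Z.of_nat w ->
  (forall u, fits w (run broadcast u (init (min_plus_input x)))) /\
  exists t, (t <= 15 * (n * n))%nat /\
    halted broadcast (run broadcast t (init (min_plus_input x))) /\
    is_min_plus n n2 n (matA x) (matB x)
      (matrix_of_cells n (fun i => mem (run broadcast t (init (min_plus_input x))) (Z.of_nat i))).
Proof.
  intros Hn Hn2 Hcase HW.
  pose proof (matA_in _ _ _ _ _ x) as HA. pose proof (matB_in _ _ _ _ _ x) as HB.
  pose proof (HA 0%nat 0%nat Hn Hn2). pose proof (HB 0%nat 0%nat Hn2 Hn).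
  destruct (broadcast_reaches w (Z.of_nat n) (Z.of_nat n2)
      (matB x 0%nat 0%nat + matA x 0%nat 0%nat) (mem (init (min_plus_input x))))
    as (t & R & m & Ht & Hr & Hm); try reflexivity; try lia; try nia.
  { apply (fits_min_plus_input w _ n n2 x); nia. }
  { f_equal.
    - rewrite Z.add_comm, <- Nat2Z.inj_mul, mem_min_plus_input.
      rewrite <- (nth_encode_pair_right _ _ _ _ _ x 0 0 Hn2 Hn). f_equal. lia.
    - change 4 with (4 + Z.of_nat 0). rewrite mem_min_plus_input.
      exact (nth_encode_pair_left _ _ _ _ _ x 0 0 Hn Hn2). }
  assert (Hh : halted broadcast (run broadcast t (init (min_plus_input x)))).
  { rewrite (proj1 Hr : run _ _ (init (min_plus_input x)) = _). left. reflexivity. }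
  split.
  - eapply reaches_halted_fits; [exact Hr|]. left. reflexivity.
  - exists t. split; [nia|]. split; [exact Hh|].
    rewrite (proj1 Hr : run _ _ (init (min_plus_input x)) = _).
    intros i j Hi Hj. unfold matrix_of_cells. cbn [mem]. rewrite Hm by nia.
    assert (Hall : forall k, (k < n2)%nat ->
              matB x 0%nat 0%nat + matA x 0%nat 0%nat = matA x i k + matB x k j).
    { intros k Hk. destruct Hcase as [HM | [H1 H2]].
      - pose proof (HA i k Hi Hk). pose proof (HB k j Hk Hj). lia.
      - replace i with 0%nat by lia. replace j with 0%nat by lia.
        replace k with 0%nat by lia. lia. }
    split; [exists 0%nat; split; [lia | apply Hall; lia]|].
    intros k Hk. rewrite (Hall k Hk). lia.
Qed.

(** * Output size *)

(** A step writes at most one cell, so the number of cells that must change bounds the time from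
    below. *)
Lemma run_changes_few_cells p t s :
  exists l, (length l <= t)%nat /\ forall a, ~ In a l -> mem (run p t s) a = mem s a.
Proof.
  induction t as [|t (l & Hl & H)]; [exists []; auto|].
  change (run p (S t) s) with (step p (run p t s)).
  unfold step. destruct (nth_error p (pc (run p t s))) as [[]|];
    try (exists l; split; [lia|]; intros; apply H; assumption).
  exists (regs (run p t s) a :: l). split; [cbn; lia|]. intros b Hb. cbn [mem].
  unfold upd_mem. destruct (Z.eqb_spec b (regs (run p t s) a)) as [->|Hne].
  - exfalso. apply Hb. left. reflexivity.
  - apply H. intros Hin. apply Hb. right. exact Hin.
Qed.

(** On zero matrices every output entry is positive, while the input cells from 1 on hold 0. So
    cells [1, ..., n * n - 1] must all be written; cell 0 is left out because it initially holds
    [n]. *)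
Lemma min_witness_output_time p t (n : nat) (s := init (Z.of_nat n ::
    row_major n n (fun _ _ => 0) ++ row_major n n (fun _ _ => 0))) :
  (1 <= n)%nat ->
  is_min_witness n (fun _ _ => 0) (fun _ _ => 0)
    (matrix_of_cells n (fun i => mem (run p t s) (Z.of_nat i))) ->
  (n * n <= t + 1)%nat.
Proof.
  intros Hn Hw. destruct (run_changes_few_cells p t s) as (l & Hl & H).
  assert (Hincl : incl (map Z.of_nat (seq 1 (n * n - 1))) l).
  { intros a Ha. apply in_map_iff in Ha. destruct Ha as (k & <- & Hk). apply in_seq in Hk.
    destruct (in_dec Z.eq_dec (Z.of_nat k) l) as [Hin|Hnin]; [exact Hin|]. exfalso.
    specialize (H _ Hnin). unfold s in H at 2. rewrite mem_init in H.
    destruct k as [|k]; [lia|]. cbn [nth] in H.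
    assert (Hd : (S k = n * (S k / n) + S k mod n)%nat) by apply Nat.div_mod_eq.
    assert (Hm : (S k mod n < n)%nat) by (apply Nat.mod_upper_bound; lia).
    assert (Hz : nth k (row_major n n (fun _ _ => 0) ++ row_major n n (fun _ _ => 0)) 0 = 0).
    { destruct (nth_in_or_default k
        (row_major n n (fun _ _ => 0) ++ row_major n n (fun _ _ => 0)) 0) as [Hin|]; [|assumption].
      assert (HF : Forall (fun v => v = 0)
                (row_major n n (fun _ _ => 0) ++ row_major n n (fun _ _ => 0)))
        by (apply Forall_app; split; apply Forall_row_major; reflexivity).
      rewrite Forall_forall in HF. apply HF, Hin. }
    destruct (Hw (S k / n)%nat (S k mod n)%nat) as [(q & _ & _ & _ & HC) | [Hno _]].
    - apply Nat.Div0.div_lt_upper_bound. lia.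
    - exact Hm.
    - unfold matrix_of_cells in HC. rewrite (Nat.mul_comm _ n), <- Hd in HC. lia.
    - exact (Hno 0%nat Hn eq_refl). }
  apply NoDup_incl_length in Hincl.
  - rewrite length_map, length_seq in Hincl. lia.
  - apply Injective_map_NoDup; [intros a b; apply Nat2Z.inj | apply seq_NoDup].
Qed.

Open Scope R_scope.

(** * Exponents, dimensions and word sizes *)

Lemma nceil_bounds x : 0 < x -> x <= INR (nceil x) < x + 1.
Proof.
  intros Hx. unfold nceil. destruct (base_Int_part (- x)) as [H1 H2].
  assert (0 <= - Int_part (- x))%Z by (apply le_IZR; rewrite opp_IZR; lra).
  rewrite INR_IZR_INZ, Z2Nat.id, opp_IZR by assumption. lra.
Qed.

Lemma nfloor_bounds x : 0 <= x -> INR (nfloor x) <= x < INR (nfloor x) + 1.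
Proof.
  intros Hx. unfold nfloor. destruct (base_Int_part x) as [H1 H2].
  assert (0 <= Int_part x)%Z.
  { apply Z.lt_succ_r, lt_IZR. rewrite succ_IZR. lra. }
  rewrite INR_IZR_INZ, Z2Nat.id by assumption. lra.
Qed.

Lemma Rpower_pos x a : 0 < Rpower x a.
Proof. apply exp_pos. Qed.

Lemma INR_ge_1 n : (1 <= n)%nat -> 1 <= INR n.
Proof. intros H. apply (le_INR 1 n H). Qed.

Lemma Rpower_ge_1 n a : (1 <= n)%nat -> 0 <= a -> 1 <= Rpower (INR n) a.
Proof.
  intros Hn Ha. apply INR_ge_1 in Hn. rewrite <- (Rpower_O (INR n)) by lra.
  apply Rle_Rpower; lra.
Qed.

(** The two powers multiply to [n]. Below, [n2 >= n^rho] and [M + 1 > n^(1-rho)]. Above, both powers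
    are at least 1, so rounding gives [n2 <= 2 n^rho] and [2M + 1 <= 3 n^(1-rho)]; hence the 6. *)
Lemma reduction_dimension n rho : (1 <= n)%nat -> 0 < rho <= 1 ->
  let n2 := npow n rho in
  let M := nfloor (Rpower (INR n) (1 - rho)) in
  (1 <= n2)%nat /\ (n <= (2 * M + 1) * n2 <= 6 * n)%nat.
Proof.
  intros Hn Hrho n2 M.
  pose proof (Rpower_ge_1 n rho Hn ltac:(lra)) as H1.
  pose proof (Rpower_ge_1 n (1 - rho) Hn ltac:(lra)) as H2.
  assert (Hprod : Rpower (INR n) rho * Rpower (INR n) (1 - rho) = INR n).
  { rewrite <- Rpower_plus. replace (rho + (1 - rho)) with 1 by ring.
    apply Rpower_1. apply INR_ge_1 in Hn. lra. }
  pose proof (nceil_bounds (Rpower (INR n) rho) ltac:(lra)) as Hc.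
  fold (npow n rho) in Hc. fold n2 in Hc.
  pose proof (nfloor_bounds (Rpower (INR n) (1 - rho)) ltac:(lra)) as Hf. fold M in Hf.
  assert (Hn2 : (1 <= n2)%nat) by (apply INR_le; cbn; lra).
  pose proof (pos_INR M).
  split; [exact Hn2|]. split; apply INR_le.
  - assert (INR n <= (INR M + 1) * INR n2) by (rewrite <- Hprod; nra).
    rewrite mult_INR, plus_INR, mult_INR. cbn [INR]. nra.
  - rewrite !mult_INR, plus_INR, mult_INR. cbn [INR]. rewrite <- Hprod. nra.
Qed.

Lemma solvable_in_O_pow_mono P a b : a <= b -> solvable_in_O_pow P a -> solvable_in_O_pow P b.
Proof.
  (* The sign of [K] is not known, and monotonicity in the exponent needs a nonnegative factor. *)
  intros Hab (p & c & K & H). exists p, c, (Rabs K). intros n Hn x.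
  destruct (H n Hn x) as [Hf (t & Ht & Hrest)]. split; [exact Hf|].
  exists t. split; [|exact Hrest]. eapply Rle_trans; [exact Ht|].
  apply Rle_trans with (Rabs K * Rpower (INR n) a).
  - apply Rmult_le_compat_r; [left; apply Rpower_pos | apply Rle_abs].
  - apply Rmult_le_compat_l; [apply Rabs_pos|].
    apply Rle_Rpower; [apply INR_ge_1, Hn | exact Hab].
Qed.

Lemma fits_mono w w' s : (w <= w')%nat -> fits w s -> fits w' s.
Proof.
  intros Hw [Hr Hm].
  assert (2 ^ Z.of_nat w <= 2 ^ Z.of_nat w')%Z by (apply Z.pow_le_mono_r; lia).
  split; intros; eapply Z.lt_le_trans; eauto.
Qed.

(** Since [N <= 8 * n], the logarithm grows by at most 3, and [4 + log2 n <= 4 * (1 + log2 n)]. The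
    summand 13 is room for the surrounding program. *)
Lemma word_size_dilate c n N : (1 <= n)%nat -> (N <= 6 * n)%nat ->
  (word_size c N <= word_size (13 + 4 * c) n)%nat.
Proof.
  intros Hn HN. unfold word_size.
  assert (H : (Nat.log2 N <= 3 + Nat.log2 n)%nat).
  { rewrite <- Nat.log2_mul_pow2 by lia. apply Nat.log2_le_mono. cbn. lia. }
  nia.
Qed.

Lemma lt_pow2_word n : (Z.of_nat n < 2 ^ Z.of_nat (S (Nat.log2 n)))%Z.
Proof.
  destruct n as [|n]; [reflexivity|].
  change 2%Z with (Z.of_nat 2). rewrite <- Nat2Z.inj_pow. apply inj_lt.
  apply Nat.log2_spec. lia.
Qed.

Lemma pow2_ge_2 k : (1 <= k)%nat -> (2 <= 2 ^ Z.of_nat k)%Z.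
Proof. intros H. change 2%Z with (2 ^ 1)%Z at 1. apply Z.pow_le_mono_r; lia. Qed.

(** With [T = 2 ^ l > n] and [T >= 2], the left side is at most [720 * T^2 + 20], while
    [T^13 >= 2048 * T^2]. *)
Lemma word_size_square c n N : (1 <= n)%nat -> (N <= 6 * n)%nat ->
  (20 * (Z.of_nat N * Z.of_nat N) + 20 < 2 ^ Z.of_nat (word_size (13 + c) n))%Z.
Proof.
  intros Hn HN. pose proof (lt_pow2_word n) as Hlt.
  pose proof (pow2_ge_2 (S (Nat.log2 n)) ltac:(lia)) as H2. unfold word_size.
  set (l := S (Nat.log2 n)) in *.
  apply Z.lt_le_trans with (2 ^ Z.of_nat (13 * l))%Z; [|apply Z.pow_le_mono_r; nia].
  rewrite (Nat.mul_comm 13 l), Nat2Z.inj_mul, Z.pow_mul_r by lia.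
  set (T := (2 ^ Z.of_nat l)%Z) in *.
  assert (Hs : (Z.of_nat N * Z.of_nat N <= 36 * (T * T))%Z) by nia.
  assert (H13 : (T ^ Z.of_nat 13 = T ^ 11 * (T * T))%Z) by (change (Z.of_nat 13) with 13%Z; ring).
  assert (H11 : (2 ^ 11 <= T ^ 11)%Z) by (apply Z.pow_le_mono_l; lia).
  change (2 ^ 11)%Z with 2048%Z in H11. rewrite H13.
  assert (4 <= T * T)%Z by nia. nia.
Qed.

(** * Transfer of running times and the lower bound *)

(** The lifted entries lie between [-N] and [N], so [kappa = 1] suffices. The condition [2 <= a]
    lets [N^a] absorb the [N * N] overhead, and [N <= 6n] costs the factor [6^a]. *)
Lemma solvable_min_plus_of_min_witness rho a : 0 < rho <= 1 -> 2 <= a ->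
  solvable_in_O_pow (MinWitnessEq 1) a ->
  solvable_in_O_pow (MStar (fun n => n) (fun n => npow n rho) (fun n => n)
                       (fun n => nfloor (Rpower (INR n) (1 - rho)))) a.
Proof.
  intros Hrho Ha (p & c & K & H).
  exists (reduce p), (13 + 4 * c)%nat, ((Rabs K + 133) * Rpower 6 a).
  intros n Hn x. cbn [instance MStar] in x.
  destruct (reduction_dimension n rho Hn Hrho) as (Hn2 & HnN & HN6).
  change (encode (MStar _ _ _ _) n x) with (min_plus_input x).
  cbn [answer MStar].
  set (n2 := npow n rho) in *. set (M := nfloor (Rpower (INR n) (1 - rho))) in *.
  set (N := ((2 * M + 1) * n2)%nat) in *.
  set (X := mem (init (min_plus_input x))).
  assert (HL : entries_in (- poly_bound 1 N) (poly_bound 1 N) N N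
                 (lifted_left (Z.of_nat n2) (Z.of_nat N) X)).
  { intros i k _ Hk. unfold poly_bound. rewrite Z.pow_1_r.
    apply lifted_left_bounds; lia. }
  assert (HE : entries_in (- poly_bound 1 N) (poly_bound 1 N) N N
                 (lifted_right (Z.of_nat n) (Z.of_nat n2) (Z.of_nat N) X)).
  { intros k j _ Hj. unfold poly_bound. rewrite Z.pow_1_r.
    apply lifted_right_bounds; lia. }
  destruct (H N ltac:(lia) (MatrixPair _ _ _ _ _ _ _ HL HE)) as [Hf (t & Ht & Hh & Hans)].
  destruct (reduce_correct p (word_size (13 + 4 * c) n) t n n2 N M x) as [Hfq (t' & Ht' & Hrest)];
    try assumption; try reflexivity.
  { apply word_size_square; assumption. }
  { intros u. eapply fits_mono; [|apply Hf]. apply word_size_dilate; assumption. }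
  split; [exact Hfq|]. exists t'. split; [|exact Hrest].
  assert (HNr : 1 <= INR N) by (apply INR_ge_1; lia).
  assert (Hsq : INR N * INR N <= Rpower (INR N) a).
  { apply Rle_trans with (Rpower (INR N) 2); [|apply Rle_Rpower; lra].
    change 2 with (INR 2). rewrite Rpower_pow by lra. cbn. lra. }
  assert (HN6r : Rpower (INR N) a <= Rpower 6 a * Rpower (INR n) a).
  { pose proof (INR_ge_1 n Hn). rewrite Rpower_mult_distr by lra.
    apply Rle_Rpower_l; [lra|]. split; [lra|].
    apply le_INR in HN6. rewrite mult_INR in HN6. replace (INR 6) with 6 in HN6 by (cbn; ring). lra. }
  apply le_INR in Ht'. rewrite plus_INR, !mult_INR in Ht'.
  replace (INR 133) with 133 in Ht' by (cbn; ring).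
  pose proof (Rpower_pos (INR N) a). pose proof (Rle_abs K). pose proof (Rabs_pos K).
  rewrite Rmult_assoc.
  apply Rle_trans with ((Rabs K + 133) * Rpower (INR N) a); nra.
Qed.

Lemma solvable_min_plus_wide rho : 1 < rho ->
  solvable_in_O_pow (MStar (fun n => n) (fun n => npow n rho) (fun n => n)
                       (fun n => nfloor (Rpower (INR n) (1 - rho)))) 2.
Proof.
  intros Hrho. set (k := nceil rho).
  pose proof (nceil_bounds rho ltac:(lra)) as Hk. fold k in Hk.
  (* The address [n * n2 + 4] must fit in a word: [k] provides for [n2 <= n ^ k], and 6 for the
     rest. *)
  exists broadcast, (k + 6)%nat, 15. intros n Hn x. cbn [instance MStar] in x.
  change (encode (MStar _ _ _ _) n x) with (min_plus_input x).
  cbn [answer MStar].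
  pose proof (INR_ge_1 n Hn) as Hnr.
  pose proof (Rpower_ge_1 n rho Hn ltac:(lra)) as H1.
  pose proof (nceil_bounds (Rpower (INR n) rho) ltac:(lra)) as Hc.
  fold (npow n rho) in Hc.
  pose proof (nfloor_bounds _ (Rlt_le _ _ (Rpower_pos (INR n) (1 - rho)))) as Hf.
  set (n2 := npow n rho) in *. set (M := nfloor (Rpower (INR n) (1 - rho))) in *.
  assert (Hn2 : (1 <= n2)%nat) by (apply INR_le; cbn; lra).
  clearbody n2 M.
  assert (Hn2k : (n2 <= n ^ k)%nat).
  { apply Nat.lt_succ_r, INR_lt. rewrite S_INR, pow_INR.
    rewrite <- Rpower_pow by lra.
    pose proof (Rle_Rpower (INR n) rho (INR k) Hnr ltac:(lra)). lra. }
  assert (Hcase : (M = 0 \/ n = 1 /\ n2 = 1 /\ M = 1)%nat).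
  { destruct (Nat.eq_dec n 1) as [->|Hne].
    - right. replace (INR 1) with 1 in * by reflexivity.
      unfold Rpower in Hc, Hf. rewrite ln_1, !Rmult_0_r, exp_0 in Hc, Hf.
      split; [reflexivity|]. split.
      + apply Nat.le_antisymm; [|exact Hn2]. apply Nat.lt_succ_r, INR_lt. cbn. lra.
      + apply Nat.le_antisymm; [apply INR_le; cbn; lra|].
        apply INR_lt. cbn. lra.
    - left. assert (1 < INR n) by (apply (lt_INR 1); lia).
      pose proof (Rpower_lt (INR n) (1 - rho) 0 ltac:(lra) ltac:(lra)) as Hlt1.
      rewrite Rpower_O in Hlt1 by lra.
      apply Nat.le_0_r, Nat.lt_succ_r, INR_lt. cbn. lra. }
  destruct (broadcast_correct (word_size (k + 6) n) n n2 M x Hn Hn2) as [Hfq (t & Ht & Hrest)].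
  { tauto. }
  { pose proof (lt_pow2_word n) as Hlt.
    pose proof (pow2_ge_2 (S (Nat.log2 n)) ltac:(lia)) as H2. unfold word_size.
    set (l := S (Nat.log2 n)) in *.
    rewrite (Nat.mul_comm _ l), Nat2Z.inj_mul, Z.pow_mul_r by lia.
    set (T := (2 ^ Z.of_nat l)%Z) in *.
    rewrite Nat2Z.inj_add, Z.pow_add_r by lia. change (Z.of_nat 6) with 6%Z.
    assert (Hn2T : (Z.of_nat n2 <= T ^ Z.of_nat k)%Z).
    { apply Z.le_trans with (Z.of_nat (n ^ k)); [lia|]. rewrite Nat2Z.inj_pow.
      apply Z.pow_le_mono_l. lia. }
    set (U := (T ^ Z.of_nat k)%Z) in *.
    replace (U * T ^ 6)%Z with (U * (T * T) * T ^ 4)%Z by ring.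
    assert (H4 : (2 ^ 4 <= T ^ 4)%Z) by (apply Z.pow_le_mono_l; lia).
    change (2 ^ 4)%Z with 16%Z in H4.
    assert (4 <= T * T)%Z by nia.
    assert (HU : (1 <= U)%Z) by lia.
    assert (Z.of_nat n * Z.of_nat n2 <= T * U)%Z by (apply Z.mul_le_mono_nonneg; lia).
    assert (Z.of_nat n * Z.of_nat n <= T * T)%Z by (apply Z.mul_le_mono_nonneg; lia).
    assert (T * U <= U * (T * T))%Z by nia.
    assert (T * T <= U * (T * T))%Z by nia.
    assert (U * (T * T) * 16 <= U * (T * T) * T ^ 4)%Z
      by (apply Z.mul_le_mono_nonneg_l; nia).
    lia. }
  split; [exact Hfq|]. exists t. split; [|exact Hrest].
  apply le_INR in Ht. rewrite !mult_INR in Ht.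
  change 2 with (INR 2). rewrite Rpower_pow by lra. cbn in Ht |- *. lra.
Qed.

(** A run in time [K n^b] with [b < 2] gives [n^2 <= K n^b + 1], which fails once
    [n^(2-b) >= |K| + 2]. *)
Lemma min_witness_requires_output_time kappa : requires_time (MinWitnessEq kappa) 2.
Proof.
  intros eps Heps Hs.
  (* Raising the exponent to at least 1 is harmless and ensures [n^b >= 1], which absorbs the
     additive 1. *)
  set (b := Rmax (2 - eps) 1).
  assert (Hb : 1 <= b < 2) by (unfold b; split; [apply Rmax_r | apply Rmax_lub_lt; lra]).
  apply (solvable_in_O_pow_mono _ _ b) in Hs; [|apply Rmax_l].
  destruct Hs as (p & c & K & H).
  set (n := nceil (Rpower (Rabs K + 2) (/ (2 - b)))).
  pose proof (Rpower_pos (Rabs K + 2) (/ (2 - b))) as Hx.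
  pose proof (nceil_bounds _ Hx) as Hc. fold n in Hc.
  assert (Hn : (1 <= n)%nat) by (apply INR_lt; cbn; lra).
  assert (H0 : entries_in (- poly_bound kappa n) (poly_bound kappa n) n n (fun _ _ => 0%Z)).
  { intros i j _ _. unfold poly_bound. pose proof (Z.pow_nonneg (Z.of_nat n) (Z.of_nat kappa)). lia. }
  destruct (H n Hn (MatrixPair _ _ _ _ _ _ _ H0 H0)) as [_ (t & Ht & _ & Hans)].
  apply min_witness_output_time in Hans; [|exact Hn].
  apply le_INR in Hans. rewrite mult_INR, plus_INR in Hans. cbn [INR] in Hans.
  pose proof (INR_ge_1 n Hn) as Hnr.
  assert (Hsplit : INR n * INR n = Rpower (INR n) (2 - b) * Rpower (INR n) b).
  { rewrite <- Rpower_plus. replace (2 - b + b) with (INR 2) by (cbn; ring).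
    rewrite Rpower_pow by lra. cbn. ring. }
  assert (Hbig : Rabs K + 2 <= Rpower (INR n) (2 - b)).
  { pose proof (Rabs_pos K).
    replace (Rabs K + 2) with (Rpower (Rpower (Rabs K + 2) (/ (2 - b))) (2 - b)).
    - apply Rle_Rpower_l; lra.
    - rewrite Rpower_mult, Rinv_l, Rpower_1 by lra. reflexivity. }
  pose proof (Rpower_ge_1 n b Hn ltac:(lra)). pose proof (Rle_abs K).
  nra.
Qed.

Theorem theorem18 (rho : R)
  (hrho : is_omega 1 rho 1 (1 + 2 * rho))
  (hM : requires_time
          (MStar (fun n => n) (fun n => npow n rho) (fun n => n)
                 (fun n => nfloor (Rpower (INR n) (1 - rho))))
          (2 + rho)) :
  exists kappa : nat, requires_time (MinWitnessEq kappa) (2 + rho).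
Proof.
  exists 1%nat. intros eps Heps Hs.
  destruct (Rle_lt_dec rho 0) as [H0|H0].
  { apply (min_witness_requires_output_time 1 eps Heps).
    apply (solvable_in_O_pow_mono _ (2 + rho - eps)); [lra | exact Hs]. }
  destruct (Rle_lt_dec rho 1) as [H1|H1].
  (* Capping the saving at [rho] keeps the exponent at least 2, as the reduction requires. *)
  - assert (Hmin : 0 < Rmin eps rho) by (apply Rmin_glb_lt; lra).
    pose proof (Rmin_l eps rho). pose proof (Rmin_r eps rho).
    apply (hM _ Hmin). apply solvable_min_plus_of_min_witness; [lra | lra |].
    apply (solvable_in_O_pow_mono _ (2 + rho - eps)); [lra | exact Hs].
  (* A saving of exactly [rho] leaves the exponent 2, which the output-sized algorithm attains. *)
  - apply (hM rho H0). replace (2 + rho - rho) with 2 by ring.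
    apply solvable_min_plus_wide, H1.
Qed.
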